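(* Let $f(z)=z+\sum_{n=2}^\infty a_nz^n$ belong to $\mathcal{K}_S$, i.e. $f$ is convex with respect to symmetric points in the unit disk $\mathbb{D}$, and let $\gamma_n$ ($n\ge 1$) be the logarithmic coefficients of $f$. Then the second Hankel determinant of logarithmic coefficients $H_{2,1}(F_f/2)=\gamma_1\gamma_3-\gamma_2^2$ satisfies $$|H_{2,1}(F_f/2)|\le \frac1{36} .$$ The inequality is sharp, i.e. there exists $f\in\mathcal{K}_S$ for which equality holds.
   Context: Let $\mathbb{D}=\{z\in\mathbb{C}:|z|<1\}$. Let $\mathcal{A}$ be the class of analytic functions $f:\mathbb{D}\to\mathbb{C}$ with $f(0)=0$ and $f'(0)=1$, written $f(z)=z+\sum_{n=2}^\infty a_nz^n$. The class $\mathcal{K}_S$ of functions convex with respect to symmetric points consists of all $f\in\mathcal{A}$ such that $$\mathrm{Re}\left(\frac{(zf'(z))'}{(f(z)-f(-z))'}\right)>0,\qquad z\in\mathbb{D},$$ where the prime denotes differentiation with respect to $z$ (so $(f(z)-f(-z))'=f'(z)+f'(-z)$) and the quotient is understood as an analytic function on $\mathbb{D}$. The logarithmic coefficients $\gamma_n$ of $f$ are defined by $$F_f(z):=\log\frac{f(z)}{z}=2\sum_{n=1}^\infty\gamma_nz^n,$$ where $f(z)/z$ is given the value $1$ at $z=0$ and the branch of the logarithm is the one with $\log 1=0$ (power series expansion at $0$). Equivalently, $\gamma_1=\frac12a_2$, $\gamma_2=\frac12\left(a_3-\frac12a_2^2\right)$, $\gamma_3=\frac12\left(a_4-a_2a_3+\frac13a_2^3\right)$.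 The second Hankel determinant of $F_f/2$ is $$H_{2,1}(F_f/2)=\begin{vmatrix}\gamma_1&\gamma_2\\ \gamma_2&\gamma_3\end{vmatrix}=\gamma_1\gamma_3-\gamma_2^2 .$$ *)

(* Defs.v *)
From Stdlib Require Export Reals.
From Coquelicot Require Export Coquelicot.
Open Scope C_scope.

Definition unit_disk (z : C) : Prop := (Cmod z < 1)%R.

(* Functions on the disk are total functions C -> C whose values outside the
   disk are irrelevant.  Analyticity is local representability by a convergent
   power series at every point of U. *)
Definition analytic_on (U : C -> Prop) (f : C -> C) : Prop :=
  forall z0 : C, U z0 ->
    exists c : nat -> C, locally z0 (fun z : C => is_pseries c (z - z0) (f z)).

Definition class_A (f : C -> C) : Prop :=
  analytic_on unit_disk f /\ f 0 = 0 /\ is_derive f (RtoC 0) (RtoC 1).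

(* The quotient (z f')' / (f(z) - f(-z))' is the analytic function q with
   q * denominator = numerator on the disk.  It is unique, since the denominator
   equals 2 at 0, and this also covers removable singularities.
   C_derive agrees with the complex derivative wherever the latter exists, which
   is the case here at every point of the disk. *)
Definition class_KS (f : C -> C) : Prop :=
  class_A f /\
  exists q : C -> C,
    analytic_on unit_disk q /\
    forall z : C, unit_disk z ->
      q z * C_derive (fun w => f w - f (- w)) z
        = C_derive (fun w => w * C_derive f w) z /\
      (0 < Re (q z))%R.

Definition Cexp (z : C) : C := (exp (Re z) * cos (Im z), exp (Re z) * sin (Im z))%R.

Definition log_series (gamma : nat -> C) (n : nat) : C :=
  match n with
  | O => 0
  | S _ => 2 * gamma n
  end.

(* F is the germ at 0 of log (f(z)/z) with F 0 = 0: it is continuous at 0, as a sum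
   of a power series, so its value at 0 selects the branch.  Only the gamma n with
   n >= 1 are constrained. *)
Definition is_log_coeffs (f : C -> C) (gamma : nat -> C) : Prop :=
  exists F : C -> C,
    F 0 = 0 /\
    locally (RtoC 0) (fun z : C => z <> 0 -> Cexp (F z) = f z / z) /\
    locally (RtoC 0) (fun z : C => is_pseries (log_series gamma) z (F z)).

Definition H21 (gamma : nat -> C) : C :=
  gamma 1%nat * gamma 3%nat - gamma 2%nat * gamma 2%nat.

(* Main.v *)
(* Write [2 q = (1 + w) / (1 - w)] for the quotient [q] in the definition of the class.  Then [w] is a
   Schwarz function, [w = c0 z + c1 z^2 + c2 z^3 + ...], and comparing coefficients gives
     2304 H = 36 c0 c2 - 20 c0^2 c1 + 11 c0^4 - 64 c1^2.
   The Schur inequalities |c1| <= 1 - |c0|^2 and |c2| <= 1 - |c0|^2 - |c1|^2 / (1 + |c0|)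
   bound this by 64 - 72 |c0|^2 + 19 |c0|^4 <= 64.  Equality holds for [w = z^2], that is [f = artanh].

   No contour integration is needed.  The maximum principle only uses second-order Taylor expansions at
   each point, and these are stable under the quotients of the Schur algorithm.  Derivatives of [f] are
   only taken inside the disk of convergence of its expansion at 0. *)

Require Import Defs.
From Stdlib Require Import Lra Lia Psatz Classical ClassicalEpsilon.

(** The factor 2 in [2 q] is a normalisation. At 0 the numerator [(z f')'] is 1 and the denominator
    is 2, so [2 q] is 1 there and has positive real part on the disk; its Cayley transform [w] is
    therefore bounded by 1 and vanishes at 0. The Schur inequalities concern [G = w / z], whose
    coefficients are [c0, c1, c2]. The main obstacle is that analyticity is given point by point: no
    single power series represents [q] on the whole disk, yet coefficients at 0 can only be bounded
    through [|G| <= 1] on circles close to the boundary. So the property carried through division by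
    [z] and through Blaschke quotients is the existence of finite expansions at every point of the
    disk. A second obstacle is the case [|c0| = 1], where the Blaschke denominator may vanish. The
    inequalities are proved for [t G] with [t < 1], and [t] then tends to 1. Sharpness needs more
    than coefficient identities: logarithmic coefficients of [artanh] must be shown to exist, so a
    convergent series for the logarithm of [artanh z / z] is constructed. *)

Lemma Cmod_minus_sym (x y : C) : Cmod (x - y) = Cmod (y - x).
Proof. rewrite <- Cmod_opp. f_equal. ring. Qed.

Lemma Cmod_triangle' (x y : C) : (Cmod x - Cmod y <= Cmod (x + y))%R.
Proof.
  pose proof (Cmod_triangle (x + y) (- y)) as H.
  rewrite Cmod_opp in H. replace (x + y + - y) with x in H by ring. lra.
Qed.

Lemma Cmod_neq_0 (h : C) : (0 < Cmod h)%R -> h <> 0.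
Proof. intros H. now apply Cmod_gt_0. Qed.

(** * Finite Taylor expansions *)

(** The neighbourhood is punctured so that both sides of an identity may be divided by [h]. *)
Definition near (P : C -> Prop) : Prop :=
  exists d : R, (0 < d)%R /\ forall h : C, (0 < Cmod h < d)%R -> P h.

Lemma near_and (P Q : C -> Prop) : near P -> near Q -> near (fun h => P h /\ Q h).
Proof.
  intros [d [Hd HP]] [e [He HQ]]. exists (Rmin d e).
  pose proof (Rmin_l d e). pose proof (Rmin_r d e).
  split. { now apply Rmin_glb_lt. }
  intros h Hh. split; [apply HP | apply HQ]; lra.
Qed.

Lemma near_imp (P Q : C -> Prop) :
  (forall h : C, h <> 0 -> P h -> Q h) -> near P -> near Q.
Proof.
  intros H [d [Hd HP]]. exists d. split; [exact Hd|].
  intros h Hh. apply H; [now apply Cmod_neq_0 | now apply HP].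
Qed.

Lemma near_all (P : C -> Prop) : (forall h : C, P h) -> near P.
Proof. intros H. exists 1%R. split; [lra|]. intros; apply H. Qed.

Lemma near_and_imp (P Q S : C -> Prop) :
  (forall h : C, h <> 0 -> P h -> Q h -> S h) -> near P -> near Q -> near S.
Proof.
  intros H HP HQ. apply (near_imp (fun h => P h /\ Q h)).
  - intros h H0 [A B]. now apply H.
  - now apply near_and.
Qed.

(* The expansion [G h = c 0 + c 1 h + ... + c (n-1) h^(n-1) + O(h^n)], with nested
   remainders so that products and quotients go by induction.  The value [G 0] plays no role. *)
Fixpoint jet (n : nat) (c : nat -> C) (G : C -> C) : Prop :=
  match n with
  | O => exists K : R, near (fun h => (Cmod (G h) <= K)%R)
  | S m => exists E : C -> C,
      near (fun h => G h = c O + h * E h) /\ jet m (fun k => c (S k)) E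
  end.

Lemma jet_ext (n : nat) (c : nat -> C) (G G' : C -> C) :
  near (fun h => G h = G' h) -> jet n c G -> jet n c G'.
Proof.
  intros HG. destruct n as [|n]; simpl.
  - intros [K HK]. exists K. revert HG HK. apply near_and_imp.
    intros h _ A B. now rewrite <- A.
  - intros [E [HE HJ]]. exists E. split; [|exact HJ].
    revert HG HE. apply near_and_imp. intros h _ A B. now rewrite <- A.
Qed.

Lemma jet_coef_ext (n : nat) (c c' : nat -> C) (G : C -> C) :
  (forall k, c k = c' k) -> jet n c G -> jet n c' G.
Proof.
  revert c c' G. induction n as [|n IH]; simpl; intros c c' G Hc; [easy|].
  intros [E [HE HJ]]. exists E. rewrite <- Hc. split; [exact HE|].
  now apply (IH (fun k => c (S k))).
Qed.

Lemma jet_weaken (n : nat) (c : nat -> C) (G : C -> C) : jet (S n) c G -> jet n c G.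
Proof.
  revert c G. induction n as [|n IH]; intros c G.
  - intros [E [HE [K HK]]]. exists (Cmod (c O) + K)%R.
    destruct HE as [d [Hd HE]]. destruct HK as [e [He HK]].
    exists (Rmin 1 (Rmin d e)).
    pose proof (Rmin_l d e). pose proof (Rmin_r d e).
    pose proof (Rmin_l 1 (Rmin d e)). pose proof (Rmin_r 1 (Rmin d e)).
    split. { repeat apply Rmin_glb_lt; lra. }
    intros h Hh. rewrite HE by lra. eapply Rle_trans; [apply Cmod_triangle|].
    rewrite Cmod_mult. assert (HK' := HK h ltac:(lra)).
    pose proof (Cmod_ge_0 (E h)). nra.
  - intros [E [HE HJ]]. exists E. split; [exact HE|]. now apply IH.
Qed.

Lemma jet_le (n m : nat) (c : nat -> C) (G : C -> C) : (m <= n)%nat -> jet n c G -> jet m c G.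
Proof. intros H. induction H; [easy|]. intros HJ. apply IHle. now apply jet_weaken. Qed.

Lemma near_zero_of_small (a : C) (K : R) : near (fun h => (Cmod a <= K * Cmod h)%R) -> a = 0.
Proof.
  intros [d [Hd H]]. apply Cmod_eq_0.
  apply Rle_antisym; [|apply Cmod_ge_0]. apply Rnot_lt_le. intros Ha.
  (* At the real point [t] the hypothesis would give [|a| <= K t <= |a| / 2]. *)
  set (t := Rmin (d / 2) (Cmod a / (2 * (Rabs K + 1)))).
  assert (HK := Rabs_pos K). assert (HK' := Rle_abs K).
  assert (Ht0 : (0 < t)%R).
  { apply Rmin_glb_lt; [lra|]. apply Rdiv_lt_0_compat; lra. }
  assert (Ht1 : (t <= d / 2)%R) by apply Rmin_l.
  assert (Ht2 : (t <= Cmod a / (2 * (Rabs K + 1)))%R) by apply Rmin_r.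
  assert (Hm : Cmod (RtoC t) = t) by (rewrite Cmod_R; apply Rabs_pos_eq; lra).
  assert (H' := H (RtoC t) ltac:(rewrite Hm; lra)). rewrite Hm in H'.
  apply Rle_div_r in Ht2; [|lra]. nra.
Qed.

Lemma jet_const (n : nat) (a : C) : jet n (fun k => match k with O => a | _ => 0 end) (fun _ => a).
Proof.
  assert (H0 : forall n, jet n (fun _ => 0) (fun _ => 0)).
  { intros m. induction m as [|m IH]; simpl.
    - exists 0%R. apply near_all. intros _. rewrite Cmod_0. lra.
    - exists (fun _ => 0). split; [|exact IH]. apply near_all. intros h. ring. }
  destruct n as [|n]; simpl.
  - exists (Cmod a). apply near_all. intros _. lra.
  - exists (fun _ => 0). split; [|apply H0]. apply near_all. intros h. ring.
Qed.

Lemma jet_id (n : nat) : jet n (fun k => match k with 1%nat => 1 | _ => 0 end) (fun h => h).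
Proof.
  (* Going through order [S n] avoids a separate case [n = 0]. *)
  apply jet_weaken. simpl. exists (fun _ => 1). split.
  - apply near_all. intros h. ring.
  - apply (jet_coef_ext _ (fun k => match k with O => RtoC 1 | _ => 0 end)).
    + intros [|k]; reflexivity.
    + apply jet_const.
Qed.

Lemma jet_plus (n : nat) (c d : nat -> C) (G H : C -> C) :
  jet n c G -> jet n d H -> jet n (fun k => c k + d k) (fun h => G h + H h).
Proof.
  revert c d G H. induction n as [|n IH]; simpl; intros c d G H.
  - intros [K HK] [L HL]. exists (K + L)%R. revert HK HL. apply near_and_imp.
    intros h _ A B. eapply Rle_trans; [apply Cmod_triangle|]. lra.
  - intros [E [HE JE]] [F [HF JF]]. exists (fun h => E h + F h). split.
    + revert HE HF. apply near_and_imp. intros h _ A B. rewrite A, B. ring.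
    + now apply (IH (fun k => c (S k)) (fun k => d (S k))).
Qed.

Lemma jet_scal (n : nat) (a : C) (c : nat -> C) (G : C -> C) :
  jet n c G -> jet n (fun k => a * c k) (fun h => a * G h).
Proof.
  revert c G. induction n as [|n IH]; simpl; intros c G.
  - intros [K HK]. exists (Cmod a * K)%R. revert HK. apply near_imp.
    intros h _ A. rewrite Cmod_mult. apply Rmult_le_compat_l; [apply Cmod_ge_0|exact A].
  - intros [E [HE JE]]. exists (fun h => a * E h). split.
    + revert HE. apply near_imp. intros h _ A. rewrite A. ring.
    + now apply (IH (fun k => c (S k))).
Qed.

(** Cauchy product. The recursion peels off the first sequence only, which matches the remainder in
    [jet_mult]: if [G = c 0 + h E] and [H = d 0 + h F], then [G H = c 0 d 0 + h (c 0 F + E H)]. *)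
Fixpoint conv (c d : nat -> C) (k : nat) : C :=
  match k with
  | O => c O * d O
  | S m => c O * d (S m) + conv (fun j => c (S j)) d m
  end.

Lemma jet_mult (n : nat) (c d : nat -> C) (G H : C -> C) :
  jet n c G -> jet n d H -> jet n (conv c d) (fun h => G h * H h).
Proof.
  revert c d G H. induction n as [|n IH]; intros c d G H.
  - intros [K HK] [L HL]. exists (K * L)%R. revert HK HL. apply near_and_imp.
    intros h _ A B. rewrite Cmod_mult. apply Rmult_le_compat; auto using Cmod_ge_0.
  - intros [E [HE JE]] JH. assert (JH' := jet_weaken _ _ _ JH). destruct JH as [F [HF JF]].
    exists (fun h => c O * F h + E h * H h). split.
    + revert HE HF. apply near_and_imp. intros h _ A B. simpl. rewrite A, B. ring.
    + apply (jet_coef_ext _ (fun k => c O * d (S k) + conv (fun j => c (S j)) d k)); [easy|].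
      apply jet_plus; [|now apply IH].
      now apply (jet_scal n (c O) (fun k => d (S k))).
Qed.

(** The constant terms differ by [h (F - E)], which is [O(h)], hence they agree; the remainders then
    agree off 0 and the induction continues with them. *)
Lemma jet_unique (n : nat) (c c' : nat -> C) (G : C -> C) (k : nat) :
  jet n c G -> jet n c' G -> (k < n)%nat -> c k = c' k.
Proof.
  revert c c' G k. induction n as [|n IH]; intros c c' G k; [lia|].
  intros [E [HE JE]] [F [HF JF]] Hk.
  assert (H0 : c O = c' O).
  { destruct (jet_le n 0 _ _ ltac:(lia) JE) as [K HK].
    destruct (jet_le n 0 _ _ ltac:(lia) JF) as [L HL].
    replace (c O) with ((c O - c' O) + c' O) by ring.
    rewrite (near_zero_of_small (c O - c' O) (K + L)); [ring|].
    generalize (near_and _ _ (near_and _ _ HE HF) (near_and _ _ HK HL)). apply near_imp.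
    intros h _ [[A B] [U V]].
    replace (c O - c' O) with ((F h - E h) * h).
    2: { replace (c O) with (G h - h * E h) by (rewrite A; ring).
         replace (c' O) with (G h - h * F h) by (rewrite B; ring). ring. }
    rewrite Cmod_mult. apply Rmult_le_compat_r; [apply Cmod_ge_0|].
    unfold Cminus. eapply Rle_trans; [apply Cmod_triangle|]. rewrite Cmod_opp. lra. }
  destruct k as [|k]; [exact H0|].
  apply (IH (fun k => c (S k)) (fun k => c' (S k)) E k); [exact JE| |lia].
  apply (jet_ext _ _ F); [|exact JF].
  revert HE HF. apply near_and_imp. intros h Hh A B. rewrite A, H0 in B.
  replace (F h) with (((c' O + h * F h) - c' O) / h) by (field; exact Hh).
  rewrite <- B. field. exact Hh.
Qed.

Lemma jet_lower_bound (c : nat -> C) (G : C -> C) :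
  jet 1 c G -> c O <> 0 -> near (fun h => (Cmod (c O) / 2 <= Cmod (G h))%R).
Proof.
  intros [E [[d [Hd HE]] [K [e [He HK]]]]] H0. apply Cmod_gt_0 in H0.
  assert (HK' := Rabs_pos K). assert (HK'' := Rle_abs K).
  set (t := (Cmod (c O) / (2 * (Rabs K + 1)))%R).
  assert (Ht : (0 < t)%R) by (apply Rdiv_lt_0_compat; lra).
  assert (Htt : (t * (Rabs K + 1) = Cmod (c O) / 2)%R) by (unfold t; field; lra).
  exists (Rmin t (Rmin d e)).
  pose proof (Rmin_l d e). pose proof (Rmin_r d e).
  pose proof (Rmin_l t (Rmin d e)). pose proof (Rmin_r t (Rmin d e)).
  split. { repeat apply Rmin_glb_lt; lra. }
  intros h Hh. rewrite HE by lra. assert (A := HK h ltac:(lra)).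
  pose proof (Cmod_triangle' (c O) (h * E h)) as B. rewrite Cmod_mult in B.
  assert (Cmod h * Cmod (E h) <= t * (Rabs K + 1))%R.
  { apply Rmult_le_compat; try apply Cmod_ge_0; lra. }
  lra.
Qed.

(** Bootstrapping on [1/G = 1/c0 - h f / (c0 G)], where [G = c0 + h f]: an expansion of [1/G] of
    order [m] on the right yields one of order [m + 1] on the left. The start is boundedness of
    [1/G]. *)
Lemma jet_inv (n : nat) (c : nat -> C) (G : C -> C) :
  jet (S n) c G -> c O <> 0 -> exists d, jet (S n) d (fun h => / G h) /\ d O = / c O.
Proof.
  intros J H0.
  assert (Hb := jet_lower_bound c G (jet_le (S n) 1 c G ltac:(lia) J) H0).
  assert (Hc := H0). apply Cmod_gt_0 in Hc.
  assert (Hstep : forall m E f, jet m E f -> forall d, jet m d (fun h => / G h) ->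
            near (fun h => G h = c O + h * f h) ->
            exists d', jet (S m) d' (fun h => / G h) /\ d' O = / c O).
  { intros m e f Jf d Jd HG.
    exists (fun k => match k with O => / c O | S j => (- / c O) * conv e d j end).
    split; [|reflexivity].
    exists (fun h => (- / c O) * (f h * / G h)). split.
    - revert HG Hb. apply near_and_imp. intros h _ A B.
      assert (G h <> 0) by (apply Cmod_gt_0; lra).
      replace (h * (- / c O * (f h * / G h))) with (- (h * f h) / (c O * G h)).
      2: { field. auto. }
      replace (h * f h) with (G h - c O) by (rewrite A; ring). field. auto.
    - apply (jet_scal m _ (conv e d)). now apply jet_mult. }
  assert (Hw : forall m, (m <= n)%nat -> exists d, jet m d (fun h => / G h)).
  { induction m as [|m IH]; intros Hm.
    (* At order 0 any coefficient sequence will do; only the bound counts. *)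
    - exists c. exists (2 / Cmod (c O))%R. revert Hb. apply near_imp. intros h _ B.
      rewrite Cmod_inv by (apply Cmod_gt_0; lra).
      replace (2 / Cmod (c O))%R with (/ (Cmod (c O) / 2))%R by (field; lra).
      apply Rinv_le_contravar; lra.
    - destruct (IH ltac:(lia)) as [d Hd].
      destruct (jet_le (S n) (S m) c G ltac:(lia) J) as [f [Hf Jf]].
      destruct (Hstep m _ f Jf d Hd Hf) as [d' [Hd' _]]. now exists d'. }
  destruct (Hw n (le_n n)) as [d Hd]. destruct J as [f [Hf Jf]].
  exact (Hstep n _ f Jf d Hd Hf).
Qed.

(** A consequence of analyticity that is easily closed under products, quotients and removal of
    singularities. Since [jet] ignores the centre, [c O = G z] is what ties the expansion to the
    value there. *)
Definition smooth_at (G : C -> C) (z : C) : Prop :=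
  forall n, exists c, jet (S n) c (fun h => G (z + h)) /\ c O = G z.

Lemma smooth_const (a z : C) : smooth_at (fun _ => a) z.
Proof. intros n. eexists. split; [apply jet_const|]. reflexivity. Qed.

Lemma smooth_plus (G H : C -> C) (z : C) :
  smooth_at G z -> smooth_at H z -> smooth_at (fun w => G w + H w) z.
Proof.
  intros HG HH n. destruct (HG n) as [c [Hc E]]. destruct (HH n) as [d [Hd F]].
  eexists. split; [exact (jet_plus _ _ _ _ _ Hc Hd)|]. simpl. now rewrite E, F.
Qed.

Lemma smooth_mult (G H : C -> C) (z : C) :
  smooth_at G z -> smooth_at H z -> smooth_at (fun w => G w * H w) z.
Proof.
  intros HG HH n. destruct (HG n) as [c [Hc E]]. destruct (HH n) as [d [Hd F]].
  eexists. split; [exact (jet_mult _ _ _ _ _ Hc Hd)|]. simpl. now rewrite E, F.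
Qed.

Lemma smooth_inv (G : C -> C) (z : C) :
  smooth_at G z -> G z <> 0 -> smooth_at (fun w => / G w) z.
Proof.
  intros HG H0 n. destruct (HG n) as [c [Hc E]]. rewrite <- E in H0.
  destruct (jet_inv _ _ _ Hc H0) as [d [Hd F]].
  exists d. split; [exact Hd|]. now rewrite F, E.
Qed.

Lemma smooth_id (z : C) : smooth_at (fun w => w) z.
Proof.
  intros n. eexists. split.
  - exact (jet_plus _ _ _ _ _ (jet_const (S n) z) (jet_id (S n))).
  - simpl. ring.
Qed.

Lemma smooth_ext (G H : C -> C) (z : C) :
  G z = H z -> near (fun h => G (z + h) = H (z + h)) -> smooth_at G z -> smooth_at H z.
Proof.
  intros E N HG n. destruct (HG n) as [c [Hc F]]. exists c. split; [|congruence].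
  revert Hc. apply jet_ext. exact N.
Qed.

Lemma smooth_div_id (G : C -> C) :
  (forall z, (Cmod z < 1)%R -> smooth_at G z) -> G 0 = 0 ->
  exists G1, (forall z, (Cmod z < 1)%R -> smooth_at G1 z) /\ forall z, G z = z * G1 z.
Proof.
  intros HG H0.
  destruct (HG 0 ltac:(rewrite Cmod_0; lra) 1%nat) as [c [Hc Ec]].
  (* The singularity at 0 is filled with the linear coefficient. An expansion of [G] one order
     longer has the quotient as its remainder, and [jet_unique] shows that every order produces the
     same value. *)
  exists (fun z => if Ceq_dec z 0 then c 1%nat else G z / z). split.
  - intros z Hz. destruct (Ceq_dec z 0) as [->|Hz0].
    + intros n. destruct (HG 0 ltac:(rewrite Cmod_0; lra) (S n)) as [d [Hd Ed]].
      assert (J2 := jet_le (S (S n)) 2 _ _ ltac:(lia) Hd).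
      destruct Hd as [E [HE JE]]. exists (fun k => d (S k)). split.
      * apply (jet_ext _ _ E); [|exact JE]. revert HE. apply near_imp. intros h Hh A.
        rewrite Cplus_0_l in *. destruct (Ceq_dec h 0); [easy|].
        rewrite A, Ed, H0. field. exact Hh.
      * destruct (Ceq_dec 0 0); [|easy].
        exact (jet_unique 2 d c _ 1 J2 Hc ltac:(lia)).
    + apply (smooth_ext (fun w => G w * / w)).
      * destruct (Ceq_dec z 0); [easy|]. reflexivity.
      * apply Cmod_gt_0 in Hz0. exists (Cmod z). split; [exact Hz0|].
        intros h Hh. destruct (Ceq_dec (z + h) 0) as [E|E]; [|reflexivity].
        exfalso. replace h with ((z + h) - z) in Hh by ring. rewrite E in Hh.
        replace (0 - z) with (- z) in Hh by ring.
        rewrite Cmod_opp in Hh. lra.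
      * apply smooth_mult; [now apply HG|]. apply smooth_inv; [apply smooth_id|exact Hz0].
  - intros z. destruct (Ceq_dec z 0) as [->|Hz0].
    + rewrite H0. ring.
    + field. exact Hz0.
Qed.

(** * Maximum principle and Schwarz-Pick *)

(** Compactness of the disk, in the one form that both halves of the extreme value theorem below can
    use. The covering is done on the square around the disk. *)
Lemma disk_lower_bound (r : R) (phi : C -> R) :
  (forall z : C, (Cmod z <= r)%R -> exists d, (0 < d)%R /\
     forall z' : C, (Cmod z' <= r)%R -> (Cmod (z' - z) < d)%R -> (d <= phi z')%R) ->
  exists d, (0 < d)%R /\ forall z : C, (Cmod z <= r)%R -> (d <= phi z)%R.
Proof.
  intros H.
  (* [compactness_value_2d] works with the maximum norm; the factor 2 absorbs the [sqrt 2] lost in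
     passing to the modulus. *)
  assert (Hd : forall w : C, exists d : posreal, forall z' : C, (Cmod z' <= r)%R ->
             (Cmod (z' - w) < 2 * d)%R -> (d <= phi z')%R).
  { intros w. destruct (Rle_dec (Cmod w) r) as [Hz|Hz].
    - destruct (H _ Hz) as [d [Hd A]].
      exists (mkposreal (d / 2) ltac:(lra)). simpl. intros z' Hz' Hzz.
      enough (d <= phi z')%R by lra. apply A; [exact Hz'|]. lra.
    (* A centre outside the disk gets a radius too small to reach any point of the disk. *)
    - exists (mkposreal ((Cmod w - r) / 2) ltac:(lra)). simpl. intros z' Hz' Hzz. exfalso.
      pose proof (Cmod_triangle z' (w - z')) as T.
      replace (z' + (w - z')) with w in T by ring.
      rewrite Cmod_minus_sym in Hzz. lra. }
  destruct (compactness_value_2d (- r) r (- r) r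
    (fun u v => proj1_sig (constructive_indefinite_description _ (Hd (u, v))))) as [d Hc].
  exists d. split; [apply cond_pos|]. intros z Hz.
  apply Rnot_lt_le. intros Hn.
  pose proof (Rmax_Cmod z) as M.
  pose proof (Rmax_l (Rabs (fst z)) (Rabs (snd z))). pose proof (Rmax_r (Rabs (fst z)) (Rabs (snd z))).
  apply (Hc (fst z) (snd z)).
  { apply Rabs_le_between. lra. }
  { apply Rabs_le_between. lra. }
  intros [u [v [_ [_ [A [B D]]]]]]. revert A B D.
  destruct (constructive_indefinite_description _ (Hd (u, v))) as [e He]. simpl. intros A B D.
  enough (e <= phi z)%R by lra. apply He; [exact Hz|].
  pose proof (Cmod_2Rmax (z - (u, v))) as T. simpl in T.
  assert (Hs : (sqrt 2 < 2)%R).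
  { pose proof (sqrt_sqrt 2 ltac:(lra)). pose proof (sqrt_pos 2). nra. }
  eapply Rle_lt_trans; [exact T|].
  apply Rmult_le_0_lt_compat; [apply sqrt_pos| |exact Hs|now apply Rmax_lub_lt].
  eapply Rle_trans; [apply Rabs_pos|apply Rmax_l].
Qed.

Definition cont_at (V : C -> R) (z : C) : Prop :=
  forall e, (0 < e)%R -> exists d, (0 < d)%R /\ forall z' : C, (Cmod (z' - z) < d)%R -> (Rabs (V z' - V z) < e)%R.

(** A uniform lower bound for [1 / (1 + |V|)] makes [V] bounded. If the supremum [m] were not
    attained, a uniform lower bound for [m - V] would contradict its minimality. *)
Lemma disk_max (r : R) (V : C -> R) :
  (0 <= r)%R -> (forall z : C, (Cmod z <= r)%R -> cont_at V z) ->
  exists z : C, (Cmod z <= r)%R /\ forall z' : C, (Cmod z' <= r)%R -> (V z' <= V z)%R.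
Proof.
  intros Hr HV.
  destruct (disk_lower_bound r (fun z => / (1 + Rabs (V z)))%R) as [b [Hb Hbd]].
  { intros z Hz. destruct (HV z Hz 1%R Rlt_0_1) as [d [Hd A]].
    assert (P := Rabs_pos (V z)).
    assert (Q : (0 < / (2 + Rabs (V z)))%R) by (apply Rinv_0_lt_compat; lra).
    exists (Rmin d (/ (2 + Rabs (V z)))). split; [now apply Rmin_glb_lt|].
    intros z' Hz' Hzz. eapply Rle_trans; [apply Rmin_r|].
    assert (B := A z' (Rlt_le_trans _ _ _ Hzz (Rmin_l _ _))).
    pose proof (Rabs_triang_inv (V z') (V z)). pose proof (Rabs_pos (V z')).
    apply Rinv_le_contravar; lra. }
  destruct (completeness (fun y => exists z : C, (Cmod z <= r)%R /\ y = V z)) as [m [Hub Hlub]].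
  { exists (/ b)%R. intros y [z [Hz ->]]. specialize (Hbd z Hz).
    pose proof (Rabs_pos (V z)). pose proof (Rle_abs (V z)).
    apply Rinv_le_contravar in Hbd; [|exact Hb]. rewrite Rinv_inv in Hbd. lra. }
  { exists (V 0), 0. split; [now rewrite Cmod_0|reflexivity]. }
  apply NNPP. intros Hno.
  assert (Hlt : forall z : C, (Cmod z <= r)%R -> (V z < m)%R).
  { intros z Hz. apply Rnot_le_lt. intros Hm. apply Hno. exists z. split; [exact Hz|].
    intros z' Hz'. eapply Rle_trans; [|exact Hm]. apply Hub. now exists z'. }
  destruct (disk_lower_bound r (fun z => m - V z)%R) as [c [Hc Hcd]].
  { intros z Hz. specialize (Hlt z Hz).
    destruct (HV z Hz ((m - V z) / 2)%R ltac:(lra)) as [d [Hd A]].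
    exists (Rmin d ((m - V z) / 2)). split; [apply Rmin_glb_lt; lra|].
    intros z' Hz' Hzz. eapply Rle_trans; [apply Rmin_r|].
    assert (B := A z' (Rlt_le_trans _ _ _ Hzz (Rmin_l _ _))).
    apply Rabs_def2 in B. lra. }
  enough (m <= m - c)%R by lra. apply Hlub. intros y [z [Hz ->]].
  specialize (Hcd z Hz). lra.
Qed.

Lemma smooth_cont (G : C -> C) (z : C) (e : R) :
  smooth_at G z -> (0 < e)%R ->
  exists d, (0 < d)%R /\ forall z' : C, (Cmod (z' - z) < d)%R -> (Cmod (G z' - G z) < e)%R.
Proof.
  intros HG He. destruct (HG 0%nat) as [c [[E [[d [Hd HE]] [K [d' [Hd' HK]]]]] Hc]].
  assert (P := Rabs_pos K). assert (Q := Rle_abs K).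
  assert (S : (0 < e / (Rabs K + 1))%R) by (apply Rdiv_lt_0_compat; lra).
  assert (SS : (e / (Rabs K + 1) * (Rabs K + 1) = e)%R) by (field; lra).
  exists (Rmin (e / (Rabs K + 1)) (Rmin d d')).
  pose proof (Rmin_l d d'). pose proof (Rmin_r d d').
  pose proof (Rmin_l (e / (Rabs K + 1)) (Rmin d d')).
  pose proof (Rmin_r (e / (Rabs K + 1)) (Rmin d d')).
  split. { repeat apply Rmin_glb_lt; lra. }
  intros z' Hz'. destruct (Ceq_dec z' z) as [->|Hne].
  { replace (G z - G z) with (RtoC 0) by ring. rewrite Cmod_0. exact He. }
  assert (Hh : (0 < Cmod (z' - z))%R).
  { apply Cmod_gt_0. intros A. apply Hne. replace z' with ((z' - z) + z) by ring. rewrite A. ring. }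
  assert (A := HE (z' - z) ltac:(lra)). assert (B := HK (z' - z) ltac:(lra)).
  replace (z + (z' - z)) with z' in A by ring.
  rewrite A, Hc. replace (G z + (z' - z) * E (z' - z) - G z) with ((z' - z) * E (z' - z)) by ring.
  rewrite Cmod_mult, <- SS. pose proof (Cmod_ge_0 (E (z' - z))). nra.
Qed.

Lemma Re_plus (x y : C) : Re (x + y) = (Re x + Re y)%R.
Proof. reflexivity. Qed.

Lemma Re_opp_le_Cmod (x : C) : (- Cmod x <= Re x <= Cmod x)%R.
Proof. pose proof (re_le_Cmod x) as H. apply Rabs_le_between in H. exact H. Qed.

(* Averaging an expansion over [h], [i h], [-h], [-i h] kills its terms of orders 1 and 2. *)
Lemma no_strict_interior_max (G : C -> C) (z : C) (e r : R) :
  smooth_at G z -> (0 < e)%R -> (0 < r)%R ->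
  ~ forall h : C, (Cmod h < r)%R ->
      (Re (G (z + h)%C) + e * Cmod (z + h) ^ 2 <= Re (G z) + e * Cmod z ^ 2)%R.
Proof.
  intros HG He Hr Hmax.
  destruct (HG 2%nat) as [c [[E [[d1 [Hd1 H1]] [F [[d2 [Hd2 H2]] [L [[d3 [Hd3 H3]] [K [d4 [Hd4 H4]]]]]]]]] Hc]].
  simpl in *.
  assert (P := Rabs_pos K). assert (Q := Rle_abs K).
  assert (S : (0 < e / (Rabs K + 1))%R) by (apply Rdiv_lt_0_compat; lra).
  assert (SS : (e / (Rabs K + 1) * (Rabs K + 1) = e)%R) by (field; lra).
  set (m := Rmin (e / (Rabs K + 1)) (Rmin r (Rmin (Rmin d1 d2) (Rmin d3 d4)))).
  assert (Hm : (0 < m)%R) by (repeat apply Rmin_glb_lt; lra).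
  assert (Hm1 : (m <= e / (Rabs K + 1))%R) by apply Rmin_l.
  assert (Hm2 : (m <= Rmin r (Rmin (Rmin d1 d2) (Rmin d3 d4)))%R) by apply Rmin_r.
  pose proof (Rmin_l r (Rmin (Rmin d1 d2) (Rmin d3 d4))).
  pose proof (Rmin_r r (Rmin (Rmin d1 d2) (Rmin d3 d4))).
  pose proof (Rmin_l (Rmin d1 d2) (Rmin d3 d4)). pose proof (Rmin_r (Rmin d1 d2) (Rmin d3 d4)).
  pose proof (Rmin_l d1 d2). pose proof (Rmin_r d1 d2).
  pose proof (Rmin_l d3 d4). pose proof (Rmin_r d3 d4).
  set (t := (m / 2)%R). assert (Ht : (0 < t < m)%R) by (unfold t; lra).
  assert (Hh : forall h : C, Cmod h = t ->
     (Re (h * c 1%nat + h * h * c 2%nat) + e * (Cmod (z + h) ^ 2 - Cmod z ^ 2) <= t * t * t * Rabs K)%R).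
  { intros h Hh. assert (A := Hmax h ltac:(lra)).
    rewrite (H1 h), (H2 h), (H3 h), Hc in A by lra.
    replace (G z + h * (c 1%nat + h * (c 2%nat + h * L h)))
      with (G z + ((h * c 1%nat + h * h * c 2%nat) + h * h * h * L h)) in A by ring.
    rewrite !(Re_plus (G z)), (Re_plus _ (h * h * h * L h)) in A.
    pose proof (Re_opp_le_Cmod (h * h * h * L h)) as B.
    rewrite !Cmod_mult, Hh in B.
    assert (D := H4 h ltac:(lra)).
    assert (t * t * t * Cmod (L h) <= t * t * t * Rabs K)%R.
    { apply Rmult_le_compat_l; [|lra]. repeat apply Rmult_le_pos; lra. }
    lra. }
  assert (M : forall x y : R, (x ^ 2 + y ^ 2 = t ^ 2)%R -> Cmod (x, y) = t).
  { intros x y Hxy. unfold Cmod. simpl fst. simpl snd. rewrite Hxy. apply sqrt_pow2. lra. }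
  assert (A1 := Hh (t, 0)%R (M (t)%R (0)%R ltac:(ring))).
  assert (A2 := Hh (0, t)%R (M (0)%R (t)%R ltac:(ring))).
  assert (A3 := Hh (- t, 0)%R (M (- t)%R (0)%R ltac:(ring))).
  assert (A4 := Hh (0, - t)%R (M (0)%R (- t)%R ltac:(ring))).
  rewrite !Cmod2_alt in A1, A2, A3, A4.
  unfold Re, Im in *. destruct z as [x y]. destruct (c 1%nat) as [a b]. destruct (c 2%nat) as [p q].
  simpl in A1, A2, A3, A4.
  (* The sum of the four inequalities: [|z + h|^2 - |z|^2] averages to [t^2], and only the cubic
     remainder is left of [G]. This is incompatible with [t < e / (|K| + 1)]. *)
  assert (X : (e * (t * t) <= t * (t * t) * Rabs K)%R) by nra.
  assert (Y : (t * Rabs K < e)%R) by nra.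
  assert (Z : (0 < (t * t) * (e - t * Rabs K))%R) by (apply Rmult_lt_0_compat; nra).
  nra.
Qed.

(** If [|G z1| > M], a rotation [u] makes [u G(z1)] real and positive. Adding [e |z|^2] to the real
    part of [u G] makes it strictly subharmonic, so its maximum over the disk cannot be interior,
    while a small [e] keeps the boundary values below the value at [z1]. *)
Lemma maximum_principle (G : C -> C) (r M : R) :
  (0 <= r)%R -> (forall z : C, (Cmod z <= r)%R -> smooth_at G z) ->
  (forall z : C, Cmod z = r -> (Cmod (G z) <= M)%R) ->
  forall z : C, (Cmod z <= r)%R -> (Cmod (G z) <= M)%R.
Proof.
  intros Hr HG HM z1 Hz1. apply Rnot_lt_le. intros Hgt.
  assert (HM0 : (0 <= M)%R).
  { eapply Rle_trans; [|apply (HM (RtoC r))]; [apply Cmod_ge_0|].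
    rewrite Cmod_R. now apply Rabs_pos_eq. }
  set (a := Cmod (G z1)) in *. assert (Ha : RtoC a <> 0).
  { intros E. apply RtoC_inj in E. lra. }
  set (u := Cconj (G z1) / a).
  assert (Hu : Cmod u = 1%R).
  { unfold u. rewrite Cmod_div, Cmod_conj, Cmod_R, Rabs_pos_eq by (auto; lra).
    fold a. field. lra. }
  assert (HuG : u * G z1 = a).
  { unfold u. replace (Cconj (G z1) / a * G z1) with ((G z1 * Cconj (G z1)) / a) by (field; exact Ha).
    rewrite <- Cmod2_conj. fold a. rewrite RtoC_pow. simpl. field. exact Ha. }
  (* This gives [e r^2 < a - M], so on the circle [M + e r^2 < a]. *)
  set (e := ((a - M) / (2 * (r * r + 1)))%R).
  assert (Hrr : (0 <= r * r)%R) by nra.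
  assert (He : (0 < e)%R) by (apply Rdiv_lt_0_compat; lra).
  assert (Her : (e * (r * r + 1) = (a - M) / 2)%R) by (unfold e; field; lra).
  set (V := fun z : C => (Re (u * G z) + e * Cmod z ^ 2)%R).
  destruct (disk_max r V Hr) as [zs [Hzs Hmax]].
  { intros z Hz eps Heps.
    destruct (smooth_cont G z (eps / 2) (HG z Hz) ltac:(lra)) as [d [Hd A]].
    set (k := (e * (2 * r + 1))%R). assert (Hk : (0 < k)%R) by (unfold k; nra).
    assert (Hq : (0 < eps / 2 / k)%R) by (apply Rdiv_lt_0_compat; lra).
    assert (Hqk : (eps / 2 / k * k = eps / 2)%R) by (field; lra).
    exists (Rmin d (Rmin 1 (eps / 2 / k))).
    pose proof (Rmin_l d (Rmin 1 (eps / 2 / k))). pose proof (Rmin_r d (Rmin 1 (eps / 2 / k))).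
    pose proof (Rmin_l 1 (eps / 2 / k)). pose proof (Rmin_r 1 (eps / 2 / k)).
    split. { repeat apply Rmin_glb_lt; lra. }
    intros z' Hz'. assert (B := A z' ltac:(lra)).
    assert (D : (Rabs (Re (u * G z') - Re (u * G z)) < eps / 2)%R).
    { replace (Re (u * G z') - Re (u * G z))%R with (Re (u * (G z' - G z))).
      2: { unfold Re. simpl. ring. }
      eapply Rle_lt_trans; [apply re_le_Cmod|]. rewrite Cmod_mult, Hu. lra. }
    assert (D2 : (Rabs (e * Cmod z' ^ 2 - e * Cmod z ^ 2) <= eps / 2)%R).
    { set (x := Cmod (z' - z)) in *.
      pose proof (Cmod_triangle z (z' - z)) as T1. replace (z + (z' - z)) with z' in T1 by ring.
      pose proof (Cmod_triangle z' (z - z')) as T2. replace (z' + (z - z')) with z in T2 by ring.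
      rewrite (Cmod_minus_sym z z') in T2. fold x in T1, T2.
      assert (Hx := Cmod_ge_0 (z' - z)). fold x in Hx.
      assert (Hy := Cmod_ge_0 z'). assert (Hw := Cmod_ge_0 z).
      replace (e * Cmod z' ^ 2 - e * Cmod z ^ 2)%R with (e * ((Cmod z' - Cmod z) * (Cmod z' + Cmod z)))%R by ring.
      rewrite Rabs_mult, (Rabs_pos_eq e), Rabs_mult, (Rabs_pos_eq (_ + _)) by lra.
      assert (Rabs (Cmod z' - Cmod z) <= x)%R by (apply Rabs_le; lra).
      assert (Rabs (Cmod z' - Cmod z) * (Cmod z' + Cmod z) <= x * (2 * r + 1))%R.
      { apply Rmult_le_compat; try lra. apply Rabs_pos. }
      apply Rle_trans with (x * k)%R; [unfold k; nra|]. rewrite <- Hqk.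
      apply Rmult_le_compat_r; lra. }
    unfold V. replace (Re (u * G z') + e * Cmod z' ^ 2 - (Re (u * G z) + e * Cmod z ^ 2))%R
      with ((Re (u * G z') - Re (u * G z)) + (e * Cmod z' ^ 2 - e * Cmod z ^ 2))%R by ring.
    eapply Rle_lt_trans; [apply Rabs_triang|]. lra. }
  assert (H1 := Hmax z1 Hz1). unfold V in H1. rewrite HuG in H1. change (Re (RtoC a)) with a in H1.
  assert (Hsq := Rle_0_sqr (Cmod z1)). unfold Rsqr in Hsq.
  assert (Hint : (Cmod zs < r)%R).
  { apply Rnot_le_lt. intros Hge. assert (Heq : Cmod zs = r) by lra.
    assert (B := HM zs Heq). assert (D := Re_opp_le_Cmod (u * G zs)).
    rewrite Cmod_mult, Hu in D. rewrite Heq in H1.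
    assert (0 <= e * (Cmod z1 * Cmod z1))%R by (apply Rmult_le_pos; lra). nra. }
  apply (no_strict_interior_max (fun z => u * G z) zs e (r - Cmod zs)%R).
  - apply smooth_mult; [apply smooth_const|now apply HG].
  - exact He.
  - lra.
  - intros h Hh. apply Hmax. eapply Rle_trans; [apply Cmod_triangle|]. lra.
Qed.

(** * Schur functions, the Schwarz lemma and the Schur algorithm *)

Definition schur_function (G : C -> C) : Prop :=
  (forall z : C, (Cmod z < 1)%R -> smooth_at G z) /\
  (forall z : C, (Cmod z < 1)%R -> (Cmod (G z) <= 1)%R).

Lemma schwarz (G : C -> C) :
  schur_function G -> G 0 = 0 ->
  exists G1, schur_function G1 /\ forall z : C, G z = z * G1 z.
Proof.
  intros [HG Hb] H0. destruct (smooth_div_id G HG H0) as [G1 [HG1 E]].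
  exists G1. split; [|exact E]. split; [exact HG1|].
  intros z Hz. apply Rnot_lt_le. intros Ha. set (a := Cmod (G1 z)) in *.
  assert (Hia : (/ a < 1)%R) by (rewrite <- Rinv_1; apply Rinv_lt_contravar; lra).
  assert (Hia0 : (0 < / a)%R) by (apply Rinv_0_lt_compat; lra).
  (* Instead of a limit [r -> 1], one radius with [r a > 1] is enough: the maximum principle gives
     [a <= 1 / r]. *)
  set (r := Rmax (Cmod z) ((1 + / a) / 2)).
  assert (Hr1 : (r < 1)%R) by (apply Rmax_lub_lt; lra).
  assert (Hr2 : (Cmod z <= r)%R) by apply Rmax_l.
  assert (Hr3 : ((1 + / a) / 2 <= r)%R) by apply Rmax_r.
  assert (M : (a <= / r)%R).
  { apply (maximum_principle G1 r (/ r)); [lra| | |exact Hr2].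
    - intros w Hw. apply HG1. lra.
    - intros w Hw. assert (A := Hb w ltac:(lra)). rewrite E, Cmod_mult, Hw in A.
      apply Rmult_le_reg_l with r; [lra|]. rewrite Rinv_r by lra. exact A. }
  apply (Rmult_le_compat_l r) in M; [|lra]. rewrite Rinv_r in M by lra.
  assert (((1 + / a) / 2) * a <= r * a)%R by (apply Rmult_le_compat_r; lra).
  replace ((1 + / a) / 2 * a)%R with ((a + 1) / 2)%R in H by (field; lra). lra.
Qed.

(** The identity behind it: [|1 - conj(a) w|^2 - |w - a|^2 = (1 - |a|^2) (1 - |w|^2)]. *)
Lemma blaschke_bound (a w : C) :
  (Cmod a < 1)%R -> (Cmod w <= 1)%R ->
  1 - Cconj a * w <> 0 /\ (Cmod ((w - a) * / (1 - Cconj a * w)) <= 1)%R.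
Proof.
  intros Ha Hw. assert (Pa := Cmod_ge_0 a). assert (Pw := Cmod_ge_0 w).
  assert (Hd : (0 < Cmod (1 - Cconj a * w))%R).
  { pose proof (Cmod_triangle' 1 (- (Cconj a * w))) as T.
    rewrite Cmod_1, Cmod_opp, Cmod_mult, Cmod_conj in T.
    unfold Cminus. nra. }
  assert (Hd0 : 1 - Cconj a * w <> 0) by now apply Cmod_gt_0.
  split; [exact Hd0|].
  rewrite Cmod_mult, Cmod_inv by exact Hd0.
  apply Rmult_le_reg_r with (Cmod (1 - Cconj a * w)); [exact Hd|].
  rewrite Rmult_assoc, Rinv_l, Rmult_1_r, Rmult_1_l by lra.
  apply Rsqr_incr_0; try apply Cmod_ge_0. rewrite !Rsqr_pow2, !Cmod2_alt.
  assert (A : (Re a ^ 2 + Im a ^ 2 <= 1)%R) by (rewrite <- Cmod2_alt; nra).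
  assert (B : (Re w ^ 2 + Im w ^ 2 <= 1)%R) by (rewrite <- Cmod2_alt; nra).
  destruct a as [p q], w as [x y]. unfold Re, Im in *. simpl in *.
  assert (D : (0 <= (1 - (p * p + q * q)) * (1 - (x * x + y * y)))%R)
    by (apply Rmult_le_pos; lra). lra.
Qed.

(** The Schwarz lemma applied to the Blaschke transform of [G]. The relation is cleared of its
    denominator so that coefficients can be compared using sums and products of expansions only. *)
Lemma schur_step (G : C -> C) :
  schur_function G -> (Cmod (G 0) < 1)%R ->
  exists S, schur_function S /\
    forall z : C, (Cmod z < 1)%R -> z * S z * (1 - Cconj (G 0) * G z) = G z - G 0.
Proof.
  intros [HG Hb] H0.
  destruct (schwarz (fun z => (G z - G 0) * / (1 - Cconj (G 0) * G z))) as [S [HS E]].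
  - split.
    + intros z Hz. apply smooth_mult.
      * apply smooth_plus; [now apply HG|apply smooth_const].
      * apply (smooth_inv (fun z => 1 - Cconj (G 0) * G z)).
        -- apply (smooth_ext (fun z => 1 + (- Cconj (G 0)) * G z)); [ring| |].
           { apply near_all. intros h. ring. }
           apply smooth_plus; [apply smooth_const|].
           apply smooth_mult; [apply smooth_const|now apply HG].
        -- now apply blaschke_bound; [|apply Hb].
    + intros z Hz. apply blaschke_bound; [exact H0|now apply Hb].
  - unfold Cminus. rewrite Cplus_opp_r. ring.
  - exists S. split; [exact HS|]. intros z Hz. rewrite <- E.
    field. apply blaschke_bound; [exact H0|now apply Hb].
Qed.

(** * Coefficient inequalities for Schur functions *)

Lemma smooth_jet_0 (G : C -> C) (n : nat) :
  smooth_at G 0 -> exists c, jet (S n) c G /\ c O = G 0.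
Proof.
  intros H. destruct (H n) as [c [J E]]. exists c. split; [|exact E].
  revert J. apply jet_ext. apply near_all. intros h. now rewrite Cplus_0_l.
Qed.

Lemma schur_jet_0 (G : C -> C) (n : nat) (c : nat -> C) :
  schur_function G -> jet (S n) c G -> c O = G 0.
Proof.
  intros [HG _] J. destruct (smooth_jet_0 G n (HG 0 ltac:(rewrite Cmod_0; lra))) as [d [Jd <-]].
  apply (jet_unique (S n) c d G); [exact J|exact Jd|lia].
Qed.

Lemma near_disk (P : C -> Prop) : (forall z : C, (Cmod z < 1)%R -> P z) -> near P.
Proof. intros H. exists 1%R. split; [lra|]. intros h Hh. apply H. lra. Qed.

Lemma schur_step_coef (G : C -> C) (c : nat -> C) :
  schur_function G -> (Cmod (G 0) < 1)%R -> jet 3 c G ->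
  exists S d, schur_function S /\ jet 2 d S /\
    c 1%nat = d O * (1 - Cmod (c O) ^ 2)%R /\
    c 2%nat = (1 - Cmod (c O) ^ 2)%R * (d 1%nat - Cconj (c O) * d O * d O).
Proof.
  intros HG H0 Jc. assert (E0 := schur_jet_0 _ _ _ HG Jc).
  destruct (schur_step G HG H0) as [S [HS E]]. rewrite <- E0 in E.
  destruct (smooth_jet_0 S 2 (proj1 HS 0 ltac:(rewrite Cmod_0; lra))) as [d [Jd _]].
  exists S, d. split; [exact HS|]. split; [now apply jet_weaken|].
  assert (J1 := jet_mult _ _ _ _ _ (jet_mult _ _ _ _ _ (jet_id 3) Jd)
     (jet_plus _ _ _ _ _ (jet_const 3 1) (jet_scal _ (- Cconj (c O)) _ _ Jc))).
  assert (J2 := jet_plus _ _ _ _ _ Jc (jet_const 3 (- c O))).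
  apply (jet_ext _ _ _ (fun h => G h + - c O)) in J1.
  2: { apply near_disk. intros z Hz. change (G z + - c O) with (G z - c O). rewrite <- (E z Hz). ring. }
  assert (K1 := jet_unique _ _ _ _ 1 J1 J2 ltac:(lia)).
  assert (K2 := jet_unique _ _ _ _ 2 J1 J2 ltac:(lia)).
  simpl in K1, K2.
  assert (N : RtoC (1 - Cmod (c O) ^ 2) = 1 - c O * Cconj (c O)).
  { rewrite RtoC_minus, Cmod2_conj. reflexivity. }
  rewrite N.
  assert (L1 : c 1%nat = d O * (1 - c O * Cconj (c O))).
  { replace (c 1%nat) with (c 1%nat + 0) by ring. rewrite <- K1. ring. }
  split; [exact L1|].
  replace (c 2%nat) with (c 2%nat + 0) by ring. rewrite <- K2, L1. ring.
Qed.

(** [schur_step] requires [|G 0| < 1], which [t G] satisfies for [t < 1]. This lemma carries the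
    inequalities for [t G] over to [t = 1]. *)
Lemma limit_le_0 (f : R -> R) :
  continuity_pt f 1 -> (forall t, (0 < t < 1)%R -> (f t <= 0)%R) -> (f 1 <= 0)%R.
Proof.
  intros Hc Hf. apply Rnot_lt_le. intros Hp.
  destruct (Hc (f 1) Hp) as [d [Hd H]].
  set (t := (1 - Rmin (d / 2) (1 / 2))%R).
  pose proof (Rmin_l (d / 2) (1 / 2)). pose proof (Rmin_r (d / 2) (1 / 2)).
  assert (0 < Rmin (d / 2) (1 / 2))%R by (apply Rmin_glb_lt; lra).
  assert (A := Hf t ltac:(unfold t; lra)).
  assert (B : (Rabs (f t - f 1) < f 1)%R).
  { apply (H t). split; [split; [exact I|unfold t; lra]|].
    simpl. unfold R_dist, Rdist, t. rewrite Rabs_left; lra. }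
  apply Rabs_def2 in B. lra.
Qed.

Lemma schur_scale (G : C -> C) (t : R) :
  (0 < t < 1)%R -> schur_function G ->
  schur_function (fun z => RtoC t * G z) /\ (Cmod (RtoC t * G 0) < 1)%R.
Proof.
  intros Ht [HG Hb].
  assert (Hm : Cmod t = t) by (rewrite Cmod_R; apply Rabs_pos_eq; lra).
  assert (forall z : C, (Cmod z < 1)%R -> (Cmod (RtoC t * G z) <= t)%R).
  { intros z Hz. rewrite Cmod_mult, Hm. specialize (Hb z Hz). pose proof (Cmod_ge_0 (G z)). nra. }
  split; [split|].
  - intros z Hz. apply smooth_mult; [apply smooth_const|now apply HG].
  - intros z Hz. specialize (H z Hz). lra.
  - specialize (H 0 ltac:(rewrite Cmod_0; lra)). lra.
Qed.

Lemma schur_coef_1 (G : C -> C) (c : nat -> C) :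
  schur_function G -> jet 2 c G -> (Cmod (c 1%nat) <= 1 - Cmod (c O) ^ 2)%R.
Proof.
  intros HG Jc2.
  (* [schur_step_coef] takes an expansion of order 3, so a longer one replaces the given one; by
     uniqueness the two coefficients in question are the same. *)
  destruct (smooth_jet_0 G 2 (proj1 HG 0 ltac:(rewrite Cmod_0; lra))) as [c' [Jc _]].
  assert (Jc' := jet_weaken _ _ _ Jc).
  rewrite (jet_unique 2 c c' G 0 Jc2 Jc'), (jet_unique 2 c c' G 1 Jc2 Jc') by lia.
  clear c Jc2 Jc'. rename c' into c.
  (* The factors 1 give the goal the literal shape [f 1] expected by [limit_le_0]. *)
  enough (A : (1 * Cmod (c 1%nat) - (1 - (1 * Cmod (c O)) ^ 2) <= 0)%R) by lra.
  apply (limit_le_0 (fun t => t * Cmod (c 1%nat) - (1 - (t * Cmod (c O)) ^ 2))%R); [reg|].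
  intros t Ht. destruct (schur_scale G t Ht HG) as [HS H0].
  destruct (schur_step_coef _ (fun k => t * c k) HS H0 (jet_scal _ _ _ _ Jc)) as [S [d [HSS [Jd [E _]]]]].
  assert (B := proj2 HSS 0 ltac:(rewrite Cmod_0; lra)). rewrite <- (schur_jet_0 _ _ _ HSS Jd) in B.
  rewrite <- (schur_jet_0 _ _ _ HS (jet_scal _ t _ _ Jc)) in H0.
  apply (f_equal Cmod) in E. rewrite !Cmod_mult, !Cmod_R in E.
  rewrite Cmod_mult, Cmod_R in H0. rewrite (Rabs_pos_eq t) in * by lra.
  assert (P := Cmod_ge_0 (c O)). set (x := (t * Cmod (c O))%R) in *.
  assert (Hx : (0 <= x)%R) by (unfold x; nra).
  rewrite Rabs_pos_eq in E by nra.
  rewrite E. assert (0 <= 1 - x ^ 2)%R by nra. nra.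
Qed.

(** A second use of the first inequality, now on the Schur transform: with [x = |c 0|] and
    [s = |d 0|] it gives [|c 2| <= (1 - x^2) (1 - (1 - x) s^2)]. Multiplying by [1 + x] turns the
    [s] term into [((1 - x^2) s)^2 = |c 1|^2], which avoids dividing by [1 - x^2]. *)
Lemma schur_coef_2 (G : C -> C) (c : nat -> C) :
  schur_function G -> jet 3 c G ->
  ((1 + Cmod (c O)) * Cmod (c 2%nat)
     <= (1 + Cmod (c O)) * (1 - Cmod (c O) ^ 2) - Cmod (c 1%nat) ^ 2)%R.
Proof.
  intros HG Jc.
  set (x0 := Cmod (c O)). set (x1 := Cmod (c 1%nat)). set (x2 := Cmod (c 2%nat)).
  enough (A : ((1 + 1 * x0) * (1 * x2) - ((1 + 1 * x0) * (1 - (1 * x0) ^ 2) - (1 * x1) ^ 2) <= 0)%R) by lra.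
  apply (limit_le_0 (fun t => (1 + t * x0) * (t * x2)
     - ((1 + t * x0) * (1 - (t * x0) ^ 2) - (t * x1) ^ 2))%R); [reg|].
  intros t Ht. destruct (schur_scale G t Ht HG) as [HS H0].
  destruct (schur_step_coef _ (fun k => t * c k) HS H0 (jet_scal _ _ _ _ Jc)) as [S [d [HSS [Jd [E1 E2]]]]].
  assert (B := schur_coef_1 S d HSS Jd).
  rewrite <- (schur_jet_0 _ _ _ HS (jet_scal _ t _ _ Jc)) in H0.
  apply (f_equal Cmod) in E1, E2.
  assert (T := Cmod_triangle (d 1%nat) (- (Cconj (t * c O) * d O * d O))).
  change (d 1%nat + - (Cconj (t * c O) * d O * d O)) with (d 1%nat - Cconj (t * c O) * d O * d O) in T.
  rewrite Cmod_opp, !Cmod_mult, Cmod_conj, !Cmod_mult in T.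
  rewrite !Cmod_mult, !Cmod_R in E1, E2. rewrite !Cmod_R in T.
  rewrite Cmod_mult, Cmod_R in H0. rewrite (Rabs_pos_eq t) in * by lra.
  fold x0 in E1, E2, H0, T. fold x1 in E1. fold x2 in E2.
  assert (P : (0 <= x0)%R) by apply Cmod_ge_0.
  assert (Hx : (0 <= t * x0)%R) by nra. set (x := (t * x0)%R) in *.
  assert (Hx2 : (0 <= 1 - x ^ 2)%R) by nra.
  rewrite Rabs_pos_eq in E1, E2 by exact Hx2.
  rewrite E1, E2. set (s := Cmod (d O)) in *.
  assert (U : (Cmod (d 1%nat - Cconj (t * c O) * d O * d O) <= 1 - s ^ 2 + x * s * s)%R) by lra.
  set (y := Cmod (d 1%nat - Cconj (t * c O) * d O * d O)) in *.
  assert (W : ((1 - x ^ 2) * y <= (1 - x ^ 2) * (1 - s ^ 2 + x * s * s))%R)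
    by (apply Rmult_le_compat_l; lra).
  apply (Rmult_le_compat_l (1 + x)) in W; [|lra]. nra.
Qed.

(** Turns the generic operations of series lemmas into those of [C], so that [ring] and [field]
    recognise them. *)
Ltac to_C := change plus with Cplus; change scal with Cmult; change opp with Copp;
  match goal with |- @eq _ ?a ?b => change (@eq C a b) end.

(** * Complex power series *)

Definition ps_on (c : nat -> C) (R : R) (f : C -> C) : Prop :=
  forall z : C, (Cmod z < R)%R -> is_pseries c z (f z).

Lemma is_pseries_C (c : nat -> C) (z l : C) :
  is_pseries c z l <-> is_series (fun n => z ^ n * c n) l.
Proof. reflexivity. Qed.

Lemma is_series_bound (a : nat -> C) (b : nat -> R) (l : C) (B : R) :
  is_series a l -> is_series b B -> (forall n, (Cmod (a n) <= b n)%R) -> (Cmod l <= B)%R.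
Proof.
  intros Ha Hb Hab.
  assert (L : Rbar_le (Finite (Cmod l)) (Finite B)); [|exact L].
  apply (is_lim_seq_le (fun n => Cmod (sum_n a n)) (sum_n b)).
  - intros n. eapply Rle_trans; [apply (norm_sum_n_m (V := C_NormedModule))|].
    apply sum_n_m_le. exact Hab.
  - apply (filterlim_comp _ _ _ (sum_n a) Cmod eventually (locally l)); [exact Ha|].
    apply (filterlim_norm (V := C_NormedModule)).
  - exact Hb.
Qed.

Lemma is_series_unique_C (a : nat -> C) (l l' : C) : is_series a l -> is_series a l' -> l = l'.
Proof. intros H H'. exact (filterlim_locally_unique (sum_n a) l l' H H'). Qed.

Lemma is_series_terms_bounded (a : nat -> C) (l : C) :
  is_series a l -> exists M, forall n, (Cmod (a n) <= M)%R.
Proof.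
  intros H. destruct (filterlim_bounded (sum_n a) (ex_intro _ l H)) as [M HM].
  assert (HM' : forall n, (Cmod (sum_n a n) <= M)%R) by exact HM.
  exists (2 * M)%R. intros [|n].
  - specialize (HM' O). rewrite sum_O in HM'. pose proof (Cmod_ge_0 (a O)). lra.
  - assert (A := HM' (S n)). assert (B := HM' n). rewrite sum_Sn in A.
    change plus with Cplus in A.
    pose proof (Cmod_triangle (sum_n a n + a (S n)) (- sum_n a n)) as T.
    replace (sum_n a n + a (S n) + - sum_n a n) with (a (S n)) in T by ring.
    rewrite Cmod_opp in T. lra.
Qed.

(** Passing to moduli makes the real theory of [CV_radius] available. Convergence at a real point
    between [r] and [R] bounds the terms there, hence the radius from below. *)
Lemma ps_on_radius (c : nat -> C) (R r : R) (f : C -> C) :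
  ps_on c R f -> (0 <= r < R)%R -> Rbar_lt r (CV_radius (fun n => Cmod (c n))).
Proof.
  intros H Hr. set (s := ((r + R) / 2)%R).
  assert (Hs : (Cmod s < R)%R) by (rewrite Cmod_R, Rabs_pos_eq; unfold s; lra).
  destruct (is_series_terms_bounded _ _ (H s Hs)) as [M HM].
  apply Rbar_lt_le_trans with (Finite s); [simpl; unfold s; lra|].
  destruct (CV_radius_bounded (fun n => Cmod (c n))) as [Hub _]. apply Hub.
  exists M. intros n. specialize (HM n).
  change (scal (pow_n (RtoC s) n) (c n)) with (s ^ n * c n) in HM.
  rewrite Cmod_mult, Cmod_pow, Cmod_R in HM.
  rewrite Rabs_mult, <- RPow_abs, (Rabs_pos_eq (Cmod _)) by apply Cmod_ge_0.
  rewrite Rmult_comm. exact HM.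
Qed.

Lemma ex_series_radius (a : nat -> R) (r : R) :
  (forall n, (0 <= a n)%R) -> (0 <= r)%R -> Rbar_lt r (CV_radius a) -> ex_series (fun n => a n * r ^ n)%R.
Proof.
  intros Ha Hr H. apply (ex_series_ext (fun n => Rabs (a n * r ^ n))).
  - intros n. apply Rabs_pos_eq. apply Rmult_le_pos; [apply Ha|now apply pow_le].
  - apply CV_disk_inside. now rewrite Rabs_pos_eq.
Qed.

(** A total function by choice; its value is arbitrary where the series diverges. *)
Definition ps_sum (c : nat -> C) (z : C) : C := epsilon (inhabits (RtoC 0)) (fun l => is_pseries c z l).

Lemma ps_sum_correct (c : nat -> C) (z : C) :
  Rbar_lt (Cmod z) (CV_radius (fun n => Cmod (c n))) -> is_pseries c z (ps_sum c z).
Proof.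
  intros H. unfold ps_sum. apply epsilon_spec.
  destruct (ex_series_le (V := C_CompleteNormedModule) (fun n => z ^ n * c n)
             (fun n => Cmod (c n) * Cmod z ^ n)%R) as [l Hl].
  - intros n. change (Cmod (z ^ n * c n) <= Cmod (c n) * Cmod z ^ n)%R.
    rewrite Cmod_mult, Cmod_pow. lra.
  - apply ex_series_radius; auto using Cmod_ge_0.
  - now exists l.
Qed.

(* Derivative with a locally quadratic error, a notion stable under all operations needed. *)
Definition has_deriv (f : C -> C) (z l : C) : Prop :=
  exists K d : R, (0 < d)%R /\ forall h : C, (Cmod h < d)%R ->
    (Cmod (f (z + h)%C - f z - l * h) <= K * Cmod h ^ 2)%R.

Lemma has_deriv_is_derive (f : C -> C) (z l : C) : has_deriv f z l -> is_derive f z l.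
Proof.
  intros [K [d [Hd H]]]. split; [apply is_linear_scal_l|].
  intros x Hx.
  apply (is_filter_lim_locally_unique (V := AbsRing_NormedModule C_AbsRing)) in Hx. subst x.
  intros eps.
  assert (P := Rabs_pos K). assert (Q := Rle_abs K).
  assert (S : (0 < eps / (Rabs K + 1))%R) by (apply Rdiv_lt_0_compat; [apply cond_pos|lra]).
  assert (SS : (eps / (Rabs K + 1) * (Rabs K + 1) = eps)%R) by (field; lra).
  assert (Hm : (0 < Rmin d (eps / (Rabs K + 1)))%R) by (apply Rmin_glb_lt; lra).
  assert (Key : forall y : C, (Cmod (y - z) < Rmin d (eps / (Rabs K + 1)))%R ->
             (Cmod (f y - f z - (y - z) * l) <= eps * Cmod (y - z))%R).
  { intros y Hy. pose proof (Rmin_l d (eps / (Rabs K + 1))). pose proof (Rmin_r d (eps / (Rabs K + 1))).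
    assert (A := H (y - z) ltac:(lra)). replace (z + (y - z)) with y in A by ring.
    rewrite (Cmult_comm (y - z) l). eapply Rle_trans; [exact A|].
    set (x := Cmod (y - z)) in *. assert (0 <= x)%R by apply Cmod_ge_0.
    simpl. rewrite Rmult_1_r, <- Rmult_assoc. apply Rmult_le_compat_r; [easy|]. nra. }
  exists (mkposreal _ Hm). exact Key.
Qed.

Lemma has_deriv_C_derive (f : C -> C) (z l : C) : has_deriv f z l -> C_derive f z = l.
Proof. intros H. apply is_C_derive_unique. now apply has_deriv_is_derive. Qed.

(** The right side is, up to [|h|^2], a term of the twice differentiated series, so summation gives
    a convergent majorant. Exponents start at 2 because degrees 0 and 1 have no second-order
    remainder. Induction: the next remainder is [z + h] times the previous one plus
    [(n + 2) z^(n+1) h^2]. *)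
Lemma pow_taylor_bound (z h : C) (r : R) (n : nat) :
  (Cmod z <= r)%R -> (Cmod (z + h) <= r)%R ->
  (Cmod ((z + h) ^ (n + 2) - z ^ (n + 2) - INR (n + 2) * z ^ (n + 1) * h)
    <= Cmod h ^ 2 * (INR (n + 1) * INR (n + 2) * r ^ n))%R.
Proof.
  intros Hz Hzh. assert (Hr : (0 <= r)%R) by (pose proof (Cmod_ge_0 z); lra).
  induction n as [|n IH].
  - simpl Nat.add. simpl INR. simpl Cpow. simpl pow.
    replace ((z + h) * ((z + h) * 1) - z * (z * 1) - RtoC (1 + 1) * (z * 1) * h) with (h * h).
    2: { rewrite RtoC_plus. ring. }
    rewrite Cmod_mult. pose proof (Cmod_ge_0 h). nra.
  - replace ((z + h) ^ (S n + 2) - z ^ (S n + 2) - INR (S n + 2) * z ^ (S n + 1) * h)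
      with ((z + h) * ((z + h) ^ (n + 2) - z ^ (n + 2) - INR (n + 2) * z ^ (n + 1) * h)
            + INR (n + 2) * z ^ (n + 1) * (h * h)).
    2: { replace (S n + 2)%nat with (S (n + 2)) by lia. replace (S n + 1)%nat with (S (n + 1)) by lia.
         rewrite S_INR, RtoC_plus, !Cpow_S. replace (n + 2)%nat with (S (n + 1)) by lia. rewrite !Cpow_S. ring. }
    eapply Rle_trans; [apply Cmod_triangle|].
    rewrite !Cmod_mult, Cmod_pow, Cmod_R, (Rabs_pos_eq (INR _)) by apply pos_INR.
    assert (A : (Cmod (z + h) * Cmod ((z + h) ^ (n + 2) - z ^ (n + 2) - INR (n + 2) * z ^ (n + 1) * h)
      <= r * (Cmod h ^ 2 * (INR (n + 1) * INR (n + 2) * r ^ n)))%R).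
    { apply Rmult_le_compat; auto using Cmod_ge_0. }
    assert (B : (Cmod z ^ (n + 1) <= r ^ (n + 1))%R) by (apply pow_incr; split; auto using Cmod_ge_0).
    assert (D : (INR (n + 2) * Cmod z ^ (n + 1) * (Cmod h * Cmod h)
      <= INR (n + 2) * r ^ (n + 1) * (Cmod h * Cmod h))%R).
    { apply Rmult_le_compat_r; [apply Rle_0_sqr|]. apply Rmult_le_compat_l; [apply pos_INR|exact B]. }
    eapply Rle_trans; [apply Rplus_le_compat; [exact A|exact D]|].
    assert (N := pos_INR n). set (X := (Cmod h ^ 2 * (r * r ^ n))%R).
    assert (E : (0 <= X)%R).
    { apply Rmult_le_pos; [apply pow2_ge_0|]. apply Rmult_le_pos; [exact Hr|now apply pow_le]. }
    assert (I1 : INR (n + 1) = (INR n + 1)%R) by (rewrite plus_INR; reflexivity).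
    assert (I2 : INR (n + 2) = (INR n + 2)%R) by (rewrite plus_INR; reflexivity).
    assert (I3 : INR (S n + 1) = (INR n + 2)%R) by (rewrite plus_INR, S_INR; simpl; ring).
    assert (I4 : INR (S n + 2) = (INR n + 3)%R) by (rewrite plus_INR, S_INR; simpl; ring).
    rewrite I1, I2, I3, I4, (pow_add r n 1).
    apply Rle_trans with (X * ((INR n + 1) * (INR n + 2) + (INR n + 2)))%R.
    { apply Req_le. unfold X. ring. }
    apply Rle_trans with (X * ((INR n + 2) * (INR n + 3)))%R.
    { apply Rmult_le_compat_l; [exact E|]. nra. }
    apply Req_le. unfold X. simpl. ring.
Qed.

Definition dcoef (c : nat -> C) (n : nat) : C := INR (S n) * c (S n).

Lemma Cmod_dcoef (c : nat -> C) (n : nat) : Cmod (dcoef c n) = PS_derive (fun n => Cmod (c n)) n.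
Proof.
  unfold dcoef, PS_derive. rewrite Cmod_mult, Cmod_R, Rabs_pos_eq; [reflexivity|apply pos_INR].
Qed.

Lemma radius_dcoef (c : nat -> C) :
  CV_radius (fun n => Cmod (dcoef c n)) = CV_radius (fun n => Cmod (c n)).
Proof.
  rewrite <- (CV_radius_derive (fun n => Cmod (c n))).
  apply CV_radius_ext. apply Cmod_dcoef.
Qed.

Lemma is_series_shift (a : nat -> C) (l : C) :
  is_series a l -> is_series (fun n => a (S n)) (l - a O).
Proof.
  intros H. apply is_series_incr_1. change plus with Cplus.
  replace (l - a O + a O) with l by ring. exact H.
Qed.

Lemma ps_derive (c : nat -> C) (R : R) (f : C -> C) :
  ps_on c R f ->
  ps_on (dcoef c) R (ps_sum (dcoef c)) /\
  forall z : C, (Cmod z < R)%R -> has_deriv f z (ps_sum (dcoef c) z).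
Proof.
  intros Hf.
  assert (Hg : ps_on (dcoef c) R (ps_sum (dcoef c))).
  { intros z Hz. apply ps_sum_correct. rewrite radius_dcoef.
    apply (ps_on_radius c R _ f Hf). split; [apply Cmod_ge_0|exact Hz]. }
  split; [exact Hg|]. intros z Hz.
  (* Both [z] and [z + h] stay in the disk of radius [r < R], where the majorant [b] converges. *)
  set (r := ((Cmod z + R) / 2)%R). assert (P := Cmod_ge_0 z).
  set (b := fun n => (INR (S n) * INR (S (S n)) * Cmod (c (S (S n))) * r ^ n)%R).
  assert (Hb : ex_series b).
  { apply (ex_series_ext (fun n => Cmod (dcoef (dcoef c) n) * r ^ n)%R).
    - intros n. unfold b, dcoef. rewrite !Cmod_mult, !Cmod_R, !Rabs_pos_eq by apply pos_INR. simpl. ring.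
    - apply ex_series_radius; [intros; apply Cmod_ge_0|unfold r; lra|].
      rewrite !radius_dcoef. apply (ps_on_radius c R r f Hf). unfold r; lra. }
  destruct Hb as [B HB]. exists B, ((R - Cmod z) / 2)%R. split; [lra|].
  intros h Hh. assert (Hzr : (Cmod z <= r)%R) by (unfold r; lra).
  assert (Hzh : (Cmod (z + h) <= r)%R).
  { eapply Rle_trans; [apply Cmod_triangle|]. unfold r. lra. }
  assert (S1 := Hf (z + h) ltac:(unfold r in Hzh; lra)).
  assert (S2 := Hf z Hz). assert (S3 := Hg z Hz).
  rewrite is_pseries_C in S1, S2, S3.
  (* Two initial terms are dropped here but only one from the derived series, whose index is already
     lowered by one; all three then start at the same coefficient [c 2]. *)
  apply is_series_shift, is_series_shift in S1. apply is_series_shift, is_series_shift in S2.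
  apply is_series_shift in S3.
  apply (is_series_scal (- h)) in S3. apply (is_series_scal (- (1))) in S2.
  assert (S4 := is_series_plus _ _ _ _ (is_series_plus _ _ _ _ S1 S2) S3).
  assert (S5 := is_series_scal (Cmod h ^ 2)%R _ _ HB). rewrite Rmult_comm.
  set (T := fun n : nat => (z + h) ^ (n + 2) - z ^ (n + 2) - INR (n + 2) * z ^ (n + 1) * h).
  apply (is_series_bound (fun n => c (S (S n)) * T n) _ _ _) with (2 := S5).
  - replace (f (z + h) - f z - ps_sum (dcoef c) z * h) with
      (plus (plus (f (z + h) - (z + h) ^ 0 * c O - (z + h) ^ 1 * c 1%nat)
        (scal (- (1)) (f z - z ^ 0 * c O - z ^ 1 * c 1%nat)))
        (scal (- h) (ps_sum (dcoef c) z - z ^ 0 * dcoef c O))).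
    2: { unfold dcoef. simpl INR. to_C. simpl Cpow. ring. }
    revert S4. apply is_series_ext. intros n. unfold T, dcoef. to_C.
    replace (n + 2)%nat with (S (S n)) by lia. replace (n + 1)%nat with (S n) by lia.
    ring.
  - intros n. rewrite Cmod_mult.
    assert (A := pow_taylor_bound z h r n Hzr Hzh). fold (T n) in A.
    apply (Rmult_le_compat_l (Cmod (c (S (S n))))) in A; [|apply Cmod_ge_0].
    eapply Rle_trans; [exact A|]. unfold b. change scal with Rmult.
    replace (n + 2)%nat with (S (S n)) by lia. replace (n + 1)%nat with (S n) by lia. apply Req_le. ring.
Qed.

Lemma ps_shift (c : nat -> C) (R : R) (f : C -> C) :
  ps_on c R f ->
  ps_on (fun n => c (S n)) R (fun z => if Ceq_dec z 0 then c 1%nat else (f z - c O) / z).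
Proof.
  intros Hf z Hz. destruct (Ceq_dec z 0) as [->|H0].
  - apply (is_pseries_0 (fun n => c (S n))).
  - assert (A := is_pseries_decr_1 c z (/ z) (f z) ltac:(now apply Cinv_l) (Hf z Hz)).
    replace ((f z - c O) / z) with (scal (/ z) (plus (f z) (opp (c O)))); [exact A|].
    to_C. field. exact H0.
Qed.

Lemma ps_value_0 (c : nat -> C) (R : R) (f : C -> C) : (0 < R)%R -> ps_on c R f -> f 0 = c O.
Proof.
  intros HR Hf. apply (is_series_unique_C (fun n => 0 ^ n * c n)).
  - apply (Hf 0). now rewrite Cmod_0.
  - apply (is_pseries_0 c).
Qed.

Lemma ps_jet (c : nat -> C) (R : R) (f : C -> C) (n : nat) :
  (0 < R)%R -> ps_on c R f -> jet n c f.
Proof.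
  intros HR. revert c f. induction n as [|n IH]; intros c f Hf.
  - destruct (proj2 (ps_derive c R f Hf) 0 ltac:(now rewrite Cmod_0)) as [K [d [Hd H]]].
    set (l := ps_sum (dcoef c) 0) in *.
    exists (Cmod (f 0) + Cmod l + Rabs K)%R. exists (Rmin d 1).
    pose proof (Rmin_l d 1). pose proof (Rmin_r d 1).
    split. { apply Rmin_glb_lt; lra. }
    intros h Hh. assert (A := H h ltac:(lra)). rewrite Cplus_0_l in A.
    replace (f h) with ((f h - f 0 - l * h) + (f 0 + l * h)) by ring.
    eapply Rle_trans; [apply Cmod_triangle|].
    assert (B := Cmod_triangle (f 0) (l * h)). rewrite Cmod_mult in B.
    assert (P := Rle_abs K). assert (Q := Rabs_pos K). assert (L := Cmod_ge_0 l).
    assert (Cmod h ^ 2 <= 1)%R by (simpl; nra).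
    assert (0 <= Cmod h ^ 2)%R by (simpl; nra).
    nra.
  - exists (fun z => if Ceq_dec z 0 then c 1%nat else (f z - c O) / z). split.
    + apply near_all. intros h. destruct (Ceq_dec h 0) as [->|H0].
      * rewrite (ps_value_0 c R f HR Hf). ring.
      * field. exact H0.
    + apply IH. now apply ps_shift.
Qed.

(** * Local analyticity and rules of differentiation *)

Lemma locally_C (z : C) (P : C -> Prop) :
  locally z P <-> exists R, (0 < R)%R /\ forall h : C, (Cmod h < R)%R -> P (z + h).
Proof.
  split.
  - intros [e He]. exists e. split; [apply cond_pos|]. intros h Hh. apply He.
    apply C_NormedModule_mixin_compat1. change minus with Cminus.
    replace (z + h - z) with h by ring. exact Hh.
  - intros [R [HR H]]. apply (locally_le_locally_norm (V := C_NormedModule)). exists (mkposreal R HR).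
    assert (Key : forall y : C, (Cmod (y - z) < R)%R -> P y).
    { intros y Hy. replace y with (z + (y - z)) by ring. now apply H. }
    exact Key.
Qed.

Lemma analytic_on_ps (U : C -> Prop) (f : C -> C) :
  analytic_on U f <->
  forall z, U z -> exists c R, (0 < R)%R /\ ps_on c R (fun h => f (z + h)).
Proof.
  split; intros H z Hz.
  - destruct (H z Hz) as [c Hc]. apply locally_C in Hc. destruct Hc as [R [HR Hc]].
    exists c, R. split; [exact HR|]. intros h Hh. specialize (Hc h Hh).
    replace (z + h - z) with h in Hc by ring. exact Hc.
  - destruct (H z Hz) as [c [R [HR Hc]]]. exists c. apply locally_C. exists R. split; [exact HR|].
    intros h Hh. replace (z + h - z) with h by ring. now apply Hc.
Qed.

Lemma analytic_smooth (U : C -> Prop) (f : C -> C) (z : C) :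
  analytic_on U f -> U z -> smooth_at f z.
Proof.
  intros Hf Hz n. destruct (proj1 (analytic_on_ps U f) Hf z Hz) as [c [R [HR Hc]]].
  exists c. split; [now apply (ps_jet c R)|].
  rewrite <- (ps_value_0 c R _ HR Hc). f_equal. ring.
Qed.

(** Normal form for the product and chain rules: a nonnegative constant, a radius at most 1, and a
    Lipschitz bound in addition to the quadratic one. *)
Lemma has_deriv_elim (f : C -> C) (z l : C) :
  has_deriv f z l -> exists K d : R, (0 <= K)%R /\ (0 < d <= 1)%R /\
    forall h : C, (Cmod h < d)%R ->
      (Cmod (f (z + h)%C - f z - l * h) <= K * Cmod h ^ 2)%R /\
      (Cmod (f (z + h)%C - f z) <= K * Cmod h)%R.
Proof.
  intros [K [d [Hd H]]]. exists (Rabs K + Cmod l)%R, (Rmin d 1).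
  assert (P := Rabs_pos K). assert (Q := Rle_abs K). assert (L := Cmod_ge_0 l).
  pose proof (Rmin_l d 1). pose proof (Rmin_r d 1).
  split; [lra|]. split. { split; [apply Rmin_glb_lt|]; lra. }
  intros h Hh. assert (A := H h ltac:(lra)). assert (B := Cmod_ge_0 h).
  assert (D := pow2_ge_0 (Cmod h)).
  split; [nra|].
  replace (f (z + h) - f z) with ((f (z + h) - f z - l * h) + l * h) by ring.
  eapply Rle_trans; [apply Cmod_triangle|]. rewrite Cmod_mult.
  assert (Cmod h ^ 2 <= Cmod h)%R by nra. nra.
Qed.

Lemma has_deriv_ext (f g : C -> C) (z l : C) :
  (exists d, (0 < d)%R /\ forall h : C, (Cmod h < d)%R -> f (z + h) = g (z + h)) ->
  has_deriv f z l -> has_deriv g z l.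
Proof.
  intros [e [He E]] [K [d [Hd H]]]. exists K, (Rmin d e).
  pose proof (Rmin_l d e). pose proof (Rmin_r d e).
  split. { now apply Rmin_glb_lt. }
  intros h Hh. assert (E0 := E 0 ltac:(rewrite Cmod_0; lra)). rewrite Cplus_0_r in E0.
  rewrite <- E0, <- E by lra. apply H. lra.
Qed.

Lemma has_deriv_const (a z : C) : has_deriv (fun _ => a) z 0.
Proof.
  exists 0%R, 1%R. split; [lra|]. intros h _.
  replace (a - a - 0 * h) with (RtoC 0) by ring. rewrite Cmod_0. lra.
Qed.

Lemma has_deriv_id (z : C) : has_deriv (fun w => w) z 1.
Proof.
  exists 0%R, 1%R. split; [lra|]. intros h _.
  replace (z + h - z - 1 * h) with (RtoC 0) by ring. rewrite Cmod_0. lra.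
Qed.

Lemma has_deriv_plus (f g : C -> C) (z l m : C) :
  has_deriv f z l -> has_deriv g z m -> has_deriv (fun w => f w + g w) z (l + m).
Proof.
  intros [K [d [Hd H]]] [L [e [He H']]]. exists (K + L)%R, (Rmin d e).
  pose proof (Rmin_l d e). pose proof (Rmin_r d e).
  split. { now apply Rmin_glb_lt. }
  intros h Hh. assert (A := H h ltac:(lra)). assert (B := H' h ltac:(lra)).
  replace (f (z + h) + g (z + h) - (f z + g z) - (l + m) * h)
    with ((f (z + h) - f z - l * h) + (g (z + h) - g z - m * h)) by ring.
  eapply Rle_trans; [apply Cmod_triangle|]. lra.
Qed.

Lemma has_deriv_mult (f g : C -> C) (z l m : C) :
  has_deriv f z l -> has_deriv g z m -> has_deriv (fun w => f w * g w) z (l * g z + f z * m).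
Proof.
  intros Hf Hg. apply has_deriv_elim in Hf, Hg.
  destruct Hf as [K [d [HK [Hd H]]]]. destruct Hg as [L [e [HL [He H']]]].
  exists (K * Cmod (g z) + L * Cmod (f z) + K * L)%R, (Rmin d e).
  pose proof (Rmin_l d e). pose proof (Rmin_r d e).
  split. { apply Rmin_glb_lt; lra. }
  intros h Hh. destruct (H h ltac:(lra)) as [A A']. destruct (H' h ltac:(lra)) as [B B'].
  replace (f (z + h) * g (z + h) - f z * g z - (l * g z + f z * m) * h)
    with ((f (z + h) - f z - l * h) * g z + (g (z + h) - g z - m * h) * f z
          + (f (z + h) - f z) * (g (z + h) - g z)) by ring.
  eapply Rle_trans; [apply Cmod_triangle|].
  eapply Rle_trans; [apply Rplus_le_compat_r, Cmod_triangle|]. rewrite !Cmod_mult.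
  apply (Rmult_le_compat_r (Cmod (g z))) in A; [|apply Cmod_ge_0].
  apply (Rmult_le_compat_r (Cmod (f z))) in B; [|apply Cmod_ge_0].
  assert (D : (Cmod (f (z + h)%C - f z) * Cmod (g (z + h)%C - g z) <= (K * Cmod h) * (L * Cmod h))%R).
  { apply Rmult_le_compat; auto using Cmod_ge_0. }
  lra.
Qed.

Lemma has_deriv_comp (f g : C -> C) (z l m : C) :
  has_deriv f z l -> has_deriv g (f z) m -> has_deriv (fun w => g (f w)) z (m * l).
Proof.
  intros Hf Hg. apply has_deriv_elim in Hf.
  destruct Hf as [K [d [HK [Hd H]]]]. destruct Hg as [L [e [He H']]].
  assert (PL := Rabs_pos L). assert (QL := Rle_abs L). assert (M := Cmod_ge_0 m).
  assert (S : (0 < e / (K + 1))%R) by (apply Rdiv_lt_0_compat; lra).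
  assert (SS : (e / (K + 1) * (K + 1) = e)%R) by (field; lra).
  exists (Rabs L * (K * K) + Cmod m * K)%R, (Rmin d (e / (K + 1))).
  pose proof (Rmin_l d (e / (K + 1))). pose proof (Rmin_r d (e / (K + 1))).
  split. { apply Rmin_glb_lt; lra. }
  intros h Hh. destruct (H h ltac:(lra)) as [A A']. assert (P := Cmod_ge_0 h).
  set (k := f (z + h) - f z) in *.
  assert (Hk : (Cmod k < e)%R) by nra.
  assert (B := H' k Hk).
  replace (f z + k) with (f (z + h)) in B by (unfold k; ring).
  replace (g (f (z + h)) - g (f z) - m * l * h) with
    ((g (f (z + h)) - g (f z) - m * k) + m * (k - l * h)) by ring.
  eapply Rle_trans; [apply Cmod_triangle|]. rewrite Cmod_mult.
  assert (Q := Cmod_ge_0 k).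
  assert (D : (L * Cmod k ^ 2 <= Rabs L * (K * Cmod h) ^ 2)%R).
  { apply Rle_trans with (Rabs L * Cmod k ^ 2)%R.
    - apply Rmult_le_compat_r; [apply pow2_ge_0|exact QL].
    - apply Rmult_le_compat_l; [exact PL|]. now apply pow_incr. }
  apply (Rmult_le_compat_l (Cmod m)) in A; [|exact M]. nra.
Qed.

Lemma has_deriv_opp_arg (f : C -> C) (z l : C) :
  has_deriv f (- z) l -> has_deriv (fun w => f (- w)) z (- l).
Proof.
  intros H. replace (- l) with (l * (0 * z + (- (1)) * 1)) by ring.
  apply (has_deriv_comp (fun w => - w) f); [|exact H].
  apply (has_deriv_ext (fun w => (- (1)) * w)).
  - exists 1%R. split; [lra|]. intros h _. ring.
  - apply (has_deriv_mult (fun _ => - (1)) (fun w => w)); [apply has_deriv_const|apply has_deriv_id].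
Qed.

(** * Complex exponential *)

Lemma Cexp_plus (z w : C) : Cexp (z + w) = Cexp z * Cexp w.
Proof.
  destruct z as [x y], w as [u v]. unfold Cexp, Cmult, Cplus, Re, Im. simpl.
  rewrite exp_plus, cos_plus, sin_plus. f_equal; ring.
Qed.

Lemma Cexp_0 : Cexp 0 = 1.
Proof. unfold Cexp, Re, Im. simpl. rewrite exp_0, cos_0, sin_0. unfold RtoC. f_equal; ring. Qed.

(** The upper bound comes from the lower one at [-x]: [exp x <= 1 / (1 - x)]. *)
Lemma exp_bounds (x : R) : (Rabs x <= 1 / 2)%R -> (1 + x <= exp x <= 1 + x + 2 * x ^ 2)%R.
Proof.
  intros H. apply Rabs_le_between in H. split; [apply exp_ineq1_le|].
  assert (A := exp_ineq1_le (- x)). rewrite exp_Ropp in A.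
  assert (P := exp_pos x).
  assert (B : ((1 - x) * exp x <= 1)%R).
  { apply Rmult_le_reg_r with (/ exp x)%R; [now apply Rinv_0_lt_compat|].
    rewrite Rmult_assoc, Rinv_r by lra. lra. }
  nra.
Qed.

Lemma sin_abs_bound (y : R) : (Rabs (sin y) <= Rabs y)%R.
Proof.
  assert (H : forall x, (0 < x)%R -> (Rabs (sin x) <= x)%R).
  { intros x Hx. apply Rabs_le. split; [|left; now apply sin_lt_x].
    destruct (Rle_dec x 3) as [L|L].
    - assert (0 <= sin x)%R; [|lra]. apply sin_ge_0; [lra|]. pose proof PI2_3_2. lra.
    - pose proof (SIN_bound x). lra. }
  destruct (Rtotal_order y 0) as [L|[->|L]].
  - assert (A := H (- y)%R ltac:(lra)). rewrite sin_neg, Rabs_Ropp in A.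
    now rewrite (Rabs_left y).
  - rewrite sin_0. lra.
  - rewrite (Rabs_pos_eq y) by lra. now apply H.
Qed.

Lemma cos_bound (y : R) : (Rabs (cos y - 1) <= y ^ 2)%R.
Proof.
  replace y with (2 * (y / 2))%R at 1 by field. rewrite cos_2a_sin.
  assert (H := sin_abs_bound (y / 2)). set (s := sin (y / 2)) in *.
  replace (1 - 2 * s * s - 1)%R with (- (2 * (s * s)))%R by ring.
  rewrite Rabs_Ropp, Rabs_pos_eq by nra.
  assert (s * s <= (y / 2) * (y / 2))%R by (apply Rsqr_le_abs_1 in H; exact H). nra.
Qed.

Lemma sin_bound_2 (y : R) : (Rabs y <= 1)%R -> (Rabs (sin y - y) <= y ^ 2)%R.
Proof.
  assert (H : forall x, (0 <= x <= 1)%R -> (Rabs (sin x - x) <= x ^ 2)%R).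
  { intros x Hx. destruct (pre_sin_bound x 0 ltac:(lra) ltac:(lra)) as [A _].
    unfold sin_approx, sin_term in A. simpl in A.
    assert (B := sin_abs_bound x). rewrite (Rabs_pos_eq x) in B by lra.
    apply Rabs_le_between in B. apply Rabs_le. nra. }
  intros Hy. apply Rabs_le_between in Hy. destruct (Rle_dec 0 y) as [L|L].
  - apply H. lra.
  - specialize (H (- y)%R ltac:(lra)). rewrite sin_neg in H.
    replace (- sin y - - y)%R with (- (sin y - y))%R in H by ring. rewrite Rabs_Ropp in H.
    replace ((- y) ^ 2)%R with (y ^ 2)%R in H by ring. exact H.
Qed.

Lemma Cmod_le_sum (x y : R) : (Cmod (x, y) <= Rabs x + Rabs y)%R.
Proof.
  apply Rsqr_incr_0; [|apply Cmod_ge_0|pose proof (Rabs_pos x); pose proof (Rabs_pos y); lra].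
  rewrite !Rsqr_pow2, Cmod2_alt. unfold Re, Im. simpl fst. simpl snd.
  rewrite <- (pow2_abs x), <- (pow2_abs y). pose proof (Rabs_pos x). pose proof (Rabs_pos y). nra.
Qed.

Lemma Cexp_taylor_bound (h : C) :
  (Cmod h <= 1 / 2)%R -> (Cmod (Cexp h - 1 - h) <= 10 * Cmod h ^ 2)%R.
Proof.
  intros Hh. assert (M := Rmax_Cmod h). rewrite Cmod2_alt.
  destruct h as [x y]. simpl in M. unfold Re, Im. simpl fst. simpl snd.
  pose proof (Rmax_l (Rabs x) (Rabs y)). pose proof (Rmax_r (Rabs x) (Rabs y)).
  destruct (exp_bounds x ltac:(lra)) as [E1 E2].
  assert (S := sin_bound_2 y ltac:(lra)). assert (D := cos_bound y).
  assert (Hx : (- (1 / 2) <= x <= 1 / 2)%R) by (apply Rabs_le_between; lra).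
  assert (Hy : (- (1 / 2) <= y <= 1 / 2)%R) by (apply Rabs_le_between; lra).
  apply Rabs_le_between in S, D.
  (* Splitting off the real exponential leaves one-variable errors. The two components contribute at
     most [4 x^2 + 6 y^2], well within the constant 10. *)
  replace (Cexp (x, y) - 1 - (x, y)) with
    (((exp x - 1 - x) + exp x * (cos y - 1))%R, (exp x * (sin y - y) + (exp x - 1) * y)%R).
  2: { unfold Cexp, Cminus, Cplus, Copp, RtoC, Re, Im. simpl. f_equal; ring. }
  eapply Rle_trans; [apply Cmod_le_sum|].
  assert (X : (0 < exp x <= 2)%R) by (pose proof (exp_pos x); nra).
  assert (A : (Rabs ((exp x - 1 - x) + exp x * (cos y - 1)) <= 2 * x ^ 2 + 2 * y ^ 2)%R).
  { apply Rabs_le. nra. }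
  assert (B : (Rabs (exp x * (sin y - y) + (exp x - 1) * y) <= 2 * y ^ 2 + 2 * (x ^ 2 + y ^ 2))%R).
  { assert (U : (Rabs (exp x - 1) <= 2 * Rabs x)%R).
    { apply Rabs_le. destruct (Rle_dec 0 x); [rewrite Rabs_pos_eq by lra|rewrite Rabs_left by lra]; nra. }
    eapply Rle_trans; [apply Rabs_triang|]. apply Rplus_le_compat.
    - apply Rabs_le. nra.
    - rewrite Rabs_mult. pose proof (Rabs_pos x). pose proof (Rabs_pos y).
      rewrite <- (pow2_abs x), <- (pow2_abs y).
      apply Rle_trans with (2 * Rabs x * Rabs y)%R; [apply Rmult_le_compat_r; lra|].
      pose proof (pow2_ge_0 (Rabs x - Rabs y)). nra. }
  nra.
Qed.

Lemma has_deriv_Cexp (z : C) : has_deriv Cexp z (Cexp z).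
Proof.
  exists (Cmod (Cexp z) * 10)%R, (1 / 2)%R. split; [lra|]. intros h Hh.
  rewrite Cexp_plus. replace (Cexp z * Cexp h - Cexp z - Cexp z * h) with (Cexp z * (Cexp h - 1 - h)) by ring.
  rewrite Cmod_mult, Rmult_assoc. apply Rmult_le_compat_l; [apply Cmod_ge_0|].
  apply Cexp_taylor_bound. lra.
Qed.

(** * The bound *)

Lemma has_deriv_unique (f : C -> C) (z l m : C) : has_deriv f z l -> has_deriv f z m -> l = m.
Proof. intros H H'. apply has_deriv_C_derive in H, H'. congruence. Qed.

Lemma jet_opp_arg (n : nat) (c : nat -> C) (G : C -> C) :
  jet n c G -> jet n (fun k => (- (1)) ^ k * c k) (fun h => G (- h)).
Proof.
  assert (N : forall P : C -> Prop, near P -> near (fun h => P (- h))).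
  { intros P [d [Hd H]]. exists d. split; [exact Hd|]. intros h Hh. apply H. now rewrite Cmod_opp. }
  revert c G. induction n as [|n IH]; simpl; intros c G.
  - intros [K HK]. exists K. apply (N _ HK).
  - intros [E [HE JE]]. exists (fun h => (- (1)) * E (- h)). split.
    + apply N in HE. revert HE. apply near_imp. intros h _ A. rewrite A. ring.
    + apply (jet_coef_ext _ (fun k => (- (1)) * ((- (1)) ^ k * c (S k)))); [intros k; ring|].
      apply (jet_scal n _ (fun k => (- (1)) ^ k * c (S k))). now apply IH.
Qed.

(** Differentiating [f = z exp F] eliminates the exponential: [z f' = f + z F' f]. Degrees 2, 3 and
    4 of this identity are the three relations. *)
Lemma is_log_coeffs_relations (f : C -> C) (gamma a : nat -> C) (R : R) :
  (0 < R)%R -> ps_on a R f -> a 0%nat = 0 -> a 1%nat = 1 -> is_log_coeffs f gamma ->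
  a 2%nat = 2 * gamma 1%nat /\
  2 * a 3%nat = 2 * gamma 1%nat * a 2%nat + 4 * gamma 2%nat /\
  3 * a 4%nat = 2 * gamma 1%nat * a 3%nat + 4 * gamma 2%nat * a 2%nat + 6 * gamma 3%nat.
Proof.
  intros HR Hf Ha0 Ha1 [F [HF0 [HE HF]]].
  apply locally_C in HE. destruct HE as [r1 [Hr1 HE]].
  apply locally_C in HF. destruct HF as [r2 [Hr2 HF]].
  assert (Hl : ps_on (log_series gamma) r2 F).
  { intros z Hz. specialize (HF z Hz). now rewrite Cplus_0_l in HF. }
  destruct (ps_derive _ _ _ Hf) as [Hg Df]. destruct (ps_derive _ _ _ Hl) as [Hm DF].
  set (g := ps_sum (dcoef a)) in *. set (m := ps_sum (dcoef (log_series gamma))) in *.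
  assert (Rel : near (fun z => f z + z * (m z * f z) = z * g z)).
  { exists (Rmin R (Rmin r1 r2)). pose proof (Rmin_l R (Rmin r1 r2)). pose proof (Rmin_r R (Rmin r1 r2)).
    pose proof (Rmin_l r1 r2). pose proof (Rmin_r r1 r2).
    split. { repeat apply Rmin_glb_lt; lra. }
    assert (Fz : forall z : C, (0 < Cmod z < Rmin R (Rmin r1 r2))%R -> z * Cexp (F z) = f z).
    { intros z Hz. assert (z <> 0) by (apply Cmod_gt_0; lra).
      assert (A := HE z ltac:(lra)). rewrite Cplus_0_l in A. rewrite A by easy. field. easy. }
    intros z Hz.
    assert (D1 := has_deriv_mult _ _ _ _ _ (has_deriv_id z)
      (has_deriv_comp _ _ _ _ _ (DF z ltac:(lra)) (has_deriv_Cexp (F z)))).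
    apply (has_deriv_ext _ f) in D1.
    (* [f = z exp F] is available off 0 only, so the radius must also keep [z + h] away from 0. *)
    2: { exists (Rmin (Cmod z) (Rmin R (Rmin r1 r2) - Cmod z))%R.
         pose proof (Rmin_l (Cmod z) (Rmin R (Rmin r1 r2) - Cmod z)).
         pose proof (Rmin_r (Cmod z) (Rmin R (Rmin r1 r2) - Cmod z)).
         split. { apply Rmin_glb_lt; lra. }
         intros h Hh. apply Fz. split.
         - pose proof (Cmod_triangle' z h). lra.
         - pose proof (Cmod_triangle z h). lra. }
    rewrite (has_deriv_unique _ _ _ _ (Df z ltac:(lra)) D1), <- (Fz z Hz). ring. }
  assert (Jf := ps_jet a R f 5 HR Hf). assert (Jg := ps_jet _ _ _ 5 HR Hg).
  assert (Jm := ps_jet _ _ _ 5 Hr2 Hm).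
  assert (J1 := jet_plus _ _ _ _ _ Jf (jet_mult _ _ _ _ _ (jet_id 5) (jet_mult _ _ _ _ _ Jm Jf))).
  assert (J2 := jet_mult _ _ _ _ _ (jet_id 5) Jg).
  apply (jet_ext _ _ _ _ Rel) in J1.
  assert (K2 := jet_unique _ _ _ _ 2 J1 J2 ltac:(lia)).
  assert (K3 := jet_unique _ _ _ _ 3 J1 J2 ltac:(lia)).
  assert (K4 := jet_unique _ _ _ _ 4 J1 J2 ltac:(lia)).
  unfold dcoef, log_series in K2, K3, K4. simpl in K2, K3, K4.
  rewrite Ha0, Ha1 in K2, K3, K4.
  repeat rewrite RtoC_plus in K2. repeat rewrite RtoC_plus in K3. repeat rewrite RtoC_plus in K4.
  repeat split.
  (* The compared coefficients [l] and [r] are large unreduced expressions, but [l - r] is the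
     difference of the two sides of the goal up to [ring]. *)
  - match type of K2 with ?l = ?r => match goal with |- _ = ?x =>
      transitivity (x - (l - r)); [ring|rewrite K2; ring] end end.
  - match type of K3 with ?l = ?r => match goal with |- _ = ?x =>
      transitivity (x - (l - r)); [ring|rewrite K3; ring] end end.
  - match type of K4 with ?l = ?r => match goal with |- _ = ?x =>
      transitivity (x - (l - r)); [ring|rewrite K4; ring] end end.
Qed.

Lemma class_A_ps (f : C -> C) :
  class_A f -> exists a R, (0 < R)%R /\ ps_on a R f /\ a 0%nat = 0 /\ a 1%nat = 1.
Proof.
  intros [Hf [H0 H1]].
  destruct (proj1 (analytic_on_ps _ _) Hf 0 ltac:(unfold unit_disk; rewrite Cmod_0; lra)) as [a [R [HR Ha]]].
  assert (Ha' : ps_on a R f).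
  { intros z Hz. specialize (Ha z Hz). cbv beta in Ha. now rewrite Cplus_0_l in Ha. }
  exists a, R. split; [exact HR|]. split; [exact Ha'|].
  split; [now rewrite <- (ps_value_0 a R f HR Ha')|].
  destruct (ps_derive a R f Ha') as [Hg D].
  assert (E := has_deriv_C_derive _ _ _ (D 0 ltac:(rewrite Cmod_0; lra))).
  rewrite (is_C_derive_unique _ _ _ H1), (ps_value_0 _ _ _ HR Hg) in E.
  rewrite E. unfold dcoef. simpl. ring.
Qed.

(** With [N] and [D] the numerator and denominator of [q], the transform [w = z G] satisfies
    [z G (2 N + D) = 2 N - D] near 0. Degrees 1, 2, 3 determine [a 2], [a 3], [a 4] in turn. *)
Lemma KS_schwarz_coef (f : C -> C) (a : nat -> C) (R : R) :
  class_KS f -> (0 < R)%R -> ps_on a R f -> a 0%nat = 0 -> a 1%nat = 1 ->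
  exists G c, schur_function G /\ jet 3 c G /\
    a 2%nat = c 0%nat / 2 /\
    a 3%nat = (c 1%nat + c 0%nat * c 0%nat) / 3 /\
    a 4%nat = (c 2%nat + 3 * c 0%nat * c 1%nat + 2 * c 0%nat * c 0%nat * c 0%nat) / 8.
Proof.
  intros [_ [q [Hq HK]]] HR Hf Ha0 Ha1.
  destruct (ps_derive _ _ _ Hf) as [Hg Df]. set (g := ps_sum (dcoef a)) in *.
  destruct (ps_derive _ _ _ Hg) as [Hgg Dg]. set (gg := ps_sum (dcoef (dcoef a))) in *.
  assert (Rel : forall z : C, (Cmod z < Rmin R 1)%R -> q z * (g z + g (- z)) = g z + z * gg z).
  { intros z Hz. pose proof (Rmin_l R 1). pose proof (Rmin_r R 1).
    destruct (HK z ltac:(unfold unit_disk; lra)) as [E _].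
    assert (D1 : has_deriv (fun w => f w - f (- w)) z (g z + g (- z))).
    { apply (has_deriv_ext (fun w => f w + (- (1)) * f (- w))).
      - exists 1%R. split; [lra|]. intros; ring.
      - replace (g z + g (- z)) with (g z + (0 * f (- z) + (- (1)) * - g (- z))) by ring.
        apply has_deriv_plus; [apply Df; lra|].
        apply (has_deriv_mult (fun _ => - (1)) (fun w => f (- w))); [apply has_deriv_const|].
        apply has_deriv_opp_arg, Df. rewrite Cmod_opp. lra. }
    assert (D2 : has_deriv (fun w => w * C_derive f w) z (g z + z * gg z)).
    { apply (has_deriv_ext (fun w => w * g w)).
      - exists (R - Cmod z)%R. split; [lra|]. intros h Hh. f_equal. symmetry.
        apply has_deriv_C_derive, Df. pose proof (Cmod_triangle z h). lra.
      - replace (g z + z * gg z) with (1 * g z + z * gg z) by ring.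
        apply has_deriv_mult; [apply has_deriv_id|apply Dg; lra]. }
    rewrite (has_deriv_C_derive _ _ _ D1), (has_deriv_C_derive _ _ _ D2) in E. exact E. }
  assert (Hden : forall z : C, (Cmod z < 1)%R -> 2 * q z + 1 <> 0).
  { intros z Hz E. destruct (HK z Hz) as [_ P]. apply (f_equal Re) in E.
    unfold Re in *. simpl in E. lra. }
  set (w := fun z => (2 * q z + - (1)) * / (2 * q z + 1)).
  assert (Hw : schur_function w).
  { split; intros z Hz.
    - assert (S : smooth_at (fun z => 2 * q z) z).
      { apply smooth_mult; [apply smooth_const|]. now apply (analytic_smooth unit_disk). }
      apply smooth_mult; [|apply smooth_inv; [|now apply Hden]];
        apply smooth_plus; try exact S; apply smooth_const.
    - unfold w. assert (D := Hden z Hz). assert (D' := D). apply Cmod_gt_0 in D'.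
      rewrite Cmod_mult, Cmod_inv by exact D.
      apply Rmult_le_reg_r with (Cmod (2 * q z + 1)); [exact D'|].
      rewrite Rmult_assoc, Rinv_l, Rmult_1_r, Rmult_1_l by lra.
      apply Rsqr_incr_0; try apply Cmod_ge_0. rewrite !Rsqr_pow2, !Cmod2_alt.
      destruct (HK z Hz) as [_ P]. unfold Re, Im in *. simpl. nra. }
  assert (w0 : w 0 = 0).
  { assert (E := Rel 0 ltac:(rewrite Cmod_0; apply Rmin_glb_lt; lra)).
    replace (- 0) with (RtoC 0) in E by ring.
    rewrite (ps_value_0 _ _ _ HR Hg) in E. unfold dcoef in E. simpl in E. rewrite Ha1 in E.
    unfold w. replace (2 * q 0 + - (1)) with (q 0 * (1 * 1 + 1 * 1) - (1 * 1 + 0 * gg 0)) by ring.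
    rewrite E. ring. }
  destruct (schwarz w Hw w0) as [G [HG EG]].
  destruct (smooth_jet_0 G 2 (proj1 HG 0 ltac:(rewrite Cmod_0; lra))) as [c [Jc _]].
  exists G, c. split; [exact HG|]. split; [exact Jc|].
  (* Comparison in degree 3 needs every factor to order 4, one more than the expansion of [G]
     returned. *)
  destruct (smooth_jet_0 G 3 (proj1 HG 0 ltac:(rewrite Cmod_0; lra))) as [c' [Jc' _]].
  assert (Jc'3 := jet_weaken _ _ _ Jc').
  rewrite !(jet_unique _ _ _ _ 0 Jc Jc'3), !(jet_unique _ _ _ _ 1 Jc Jc'3),
    !(jet_unique _ _ _ _ 2 Jc Jc'3) by lia.
  clear c Jc Jc'3. rename c' into c. rename Jc' into Jc.
  assert (Jg := ps_jet _ _ _ 4 HR Hg). assert (Jgg := ps_jet _ _ _ 4 HR Hgg).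
  assert (Jn := jet_scal _ 2 _ _ (jet_plus _ _ _ _ _ Jg (jet_mult _ _ _ _ _ (jet_id 4) Jgg))).
  assert (Jd := jet_plus _ _ _ _ _ Jg (jet_opp_arg _ _ _ Jg)).
  assert (J1 := jet_mult _ _ _ _ _ (jet_mult _ _ _ _ _ (jet_id 4) Jc) (jet_plus _ _ _ _ _ Jn Jd)).
  assert (J2 := jet_plus _ _ _ _ _ Jn (jet_scal _ (- (1)) _ _ Jd)).
  apply (jet_ext _ _ _ (fun h => 2 * (g h + h * gg h) + - (1) * (g h + g (- h)))) in J1.
  2: { exists (Rmin R 1). split; [apply Rmin_glb_lt; lra|]. intros z Hz.
       pose proof (Rmin_r R 1).
       rewrite <- EG, <- Rel by lra. unfold w. field. apply Hden. lra. }
  assert (K1 := jet_unique _ _ _ _ 1 J1 J2 ltac:(lia)).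
  assert (K2 := jet_unique _ _ _ _ 2 J1 J2 ltac:(lia)).
  assert (K3 := jet_unique _ _ _ _ 3 J1 J2 ltac:(lia)).
  clear - K1 K2 K3 Ha0 Ha1. unfold dcoef in K1, K2, K3. simpl in K1, K2, K3.
  rewrite Ha1 in K1, K2, K3.
  repeat rewrite RtoC_plus in K1. repeat rewrite RtoC_plus in K2. repeat rewrite RtoC_plus in K3.
  assert (A2 : a 2%nat = c 0%nat / 2).
  (* The divisors 8, 12 and 32 are the factors with which [a 2], [a 3] and [a 4] enter [2 N - D] in
     degrees 1, 2 and 3. *)
  { match type of K1 with ?l = ?r => transitivity (a 2%nat + (l - r) / 8);
      [rewrite K1; field|field] end. }
  assert (A3 : a 3%nat = (c 1%nat + c 0%nat * c 0%nat) / 3).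
  { match type of K2 with ?l = ?r => transitivity (a 3%nat + (l - r) / (3 * 2 * 2));
      [rewrite K2; field|rewrite A2; field] end. }
  split; [exact A2|]. split; [exact A3|].
  match type of K3 with ?l = ?r => transitivity (a 4%nat + (l - r) / (8 * 2 * 2));
      [rewrite K3; field|rewrite A2, A3; field] end.
Qed.

(** After multiplication by [1 + x] and elimination of [u], the coefficient of [y^2] is
    [64 (1 + x) - 36 x = 64 + 28 x > 0]. The expression thus increases with [y], the worst case is
    [y = 1 - x^2], and the slack left there is the quantity in [E]. *)
Lemma hankel_inequality (x y u : R) :
  (0 <= x)%R -> (0 <= y)%R -> (y <= 1 - x ^ 2)%R ->
  ((1 + x) * u <= (1 + x) * (1 - x ^ 2) - y ^ 2)%R ->
  (36 * x * u + 20 * x ^ 2 * y + 11 * x ^ 4 + 64 * y ^ 2 <= 64)%R.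
Proof.
  intros Hx Hy Hxy Hu.
  assert (Hx1 : (x <= 1)%R) by nra.
  apply Rmult_le_reg_l with (1 + x)%R; [lra|].
  assert (A : (x * ((1 + x) * u) <= x * ((1 + x) * (1 - x ^ 2) - y ^ 2))%R) by (apply Rmult_le_compat_l; lra).
  assert (B : (y ^ 2 <= (1 - x ^ 2) ^ 2)%R) by (apply pow_incr; lra).
  assert (B' : ((64 + 28 * x) * y ^ 2 <= (64 + 28 * x) * (1 - x ^ 2) ^ 2)%R) by (apply Rmult_le_compat_l; lra).
  assert (D : ((1 + x) * x ^ 2 * y <= (1 + x) * x ^ 2 * (1 - x ^ 2))%R).
  { apply Rmult_le_compat_l; [|lra]. apply Rmult_le_pos; [lra|apply pow2_ge_0]. }
  assert (E : (0 <= (1 + x) * x ^ 2 * (72 - 19 * x ^ 2))%R).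
  { apply Rmult_le_pos; [apply Rmult_le_pos; [lra|apply pow2_ge_0]|nra]. }
  lra.
Qed.

Lemma KS_hankel_bound (f : C -> C) (gamma : nat -> C) :
  class_KS f -> is_log_coeffs f gamma -> (Cmod (H21 gamma) <= 1 / 36)%R.
Proof.
  intros HK HL. destruct (class_A_ps f (proj1 HK)) as [a [r [Hr [Hf [Ha0 Ha1]]]]].
  destruct (is_log_coeffs_relations f gamma a r Hr Hf Ha0 Ha1 HL) as [G1 [G2 G3]].
  destruct (KS_schwarz_coef f a r HK Hr Hf Ha0 Ha1) as [G [c [HG [Jc [A2 [A3 A4]]]]]].
  assert (B1 := schur_coef_1 G c HG (jet_weaken _ _ _ Jc)).
  assert (B2 := schur_coef_2 G c HG Jc).
  set (c0 := c 0%nat) in *. set (c1 := c 1%nat) in *. set (c2 := c 2%nat) in *.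
  (* [2304 = 48^2], where 48 is a common denominator of the first three logarithmic coefficients
     written in [c0, c1, c2]. *)
  assert (E : 2304 * H21 gamma = 36 * c0 * c2 + - (20 * c0 * c0 * c1) + 11 * c0 * c0 * c0 * c0 + - (64 * c1 * c1)).
  { unfold H21.
    assert (E1 : gamma 1%nat = a 2%nat / 2) by (rewrite G1; field).
    assert (E2 : gamma 2%nat = (2 * a 3%nat - 2 * gamma 1%nat * a 2%nat) / 4).
    { rewrite G2. field. }
    assert (E3 : gamma 3%nat = (3 * a 4%nat - 2 * gamma 1%nat * a 3%nat - 4 * gamma 2%nat * a 2%nat) / 6).
    { rewrite G3. field. }
    rewrite E3, E2, E1, A4, A3, A2. field. }
  assert (M : (2304 * Cmod (H21 gamma) <= 64)%R).
  { replace 2304%R with (Cmod 2304) at 1 by (rewrite Cmod_R; apply Rabs_pos_eq; lra).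
    rewrite <- Cmod_mult, E.
    eapply Rle_trans; [|apply (hankel_inequality (Cmod c0) (Cmod c1) (Cmod c2)); auto using Cmod_ge_0].
    eapply Rle_trans; [apply Cmod_triangle|].
    eapply Rle_trans; [apply Rplus_le_compat_r, Cmod_triangle|].
    eapply Rle_trans; [apply Rplus_le_compat_r, Rplus_le_compat_r, Cmod_triangle|].
    rewrite !Cmod_opp, !Cmod_mult, !Cmod_R, !Rabs_pos_eq by lra. lra. }
  lra.
Qed.

(** * Logarithms of power series *)

Lemma fst_sum_n (a : nat -> C) (n : nat) : fst (sum_n a n) = sum_n (fun k => fst (a k)) n.
Proof.
  induction n as [|n IH]; [now rewrite !sum_O|]. rewrite !sum_Sn, <- IH. reflexivity.
Qed.

Lemma snd_sum_n (a : nat -> C) (n : nat) : snd (sum_n a n) = sum_n (fun k => snd (a k)) n.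
Proof.
  induction n as [|n IH]; [now rewrite !sum_O|]. rewrite !sum_Sn, <- IH. reflexivity.
Qed.

Lemma is_series_C (a : nat -> C) (l : C) :
  is_series a l <->
  is_series (fun n => fst (a n)) (fst l) /\ is_series (fun n => snd (a n)) (snd l).
Proof.
  split.
  - intros H. split.
    + apply (filterlim_ext (fun n => fst (sum_n a n))); [apply fst_sum_n|].
      apply (filterlim_comp _ _ _ (sum_n a) fst _ (locally l)); [exact H|].
      intros P [e He]. exists e. intros y [Hy _]. now apply He.
    + apply (filterlim_ext (fun n => snd (sum_n a n))); [apply snd_sum_n|].
      apply (filterlim_comp _ _ _ (sum_n a) snd _ (locally l)); [exact H|].
      intros P [e He]. exists e. intros y [_ Hy]. now apply He.
  - intros [H1 H2] P [e He].
    assert (A := H1 (ball (fst l) e) (ex_intro _ e (fun y H => H))).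
    assert (B := H2 (ball (snd l) e) (ex_intro _ e (fun y H => H))).
    destruct A as [N1 A], B as [N2 B]. exists (Nat.max N1 N2). intros n Hn. apply He. split.
    + rewrite fst_sum_n. apply A. lia.
    + rewrite snd_sum_n. apply B. lia.
Qed.

Lemma conv_sum_n (a b : nat -> C) (n : nat) : conv a b n = sum_n (fun k => a k * b (n - k)%nat) n.
Proof.
  revert a. induction n as [|n IH]; intros a.
  - now rewrite sum_O.
  - simpl conv. rewrite IH. unfold sum_n.
    rewrite (sum_Sn_m _ 0 (S n)) by lia. rewrite <- sum_n_m_S. reflexivity.
Qed.

Lemma ex_series_components (a : nat -> C) :
  ex_series (fun n => Cmod (a n)) ->
  ex_series (fun n => Rabs (fst (a n))) /\ ex_series (fun n => Rabs (snd (a n))).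
Proof.
  intros H. split; apply (ex_series_le (V := R_CompleteNormedModule) _ (fun n => Cmod (a n))); auto; intros n;
    change norm with Rabs; rewrite Rabs_Rabsolu;
    (eapply Rle_trans; [|apply Rmax_Cmod]); [apply Rmax_l|apply Rmax_r].
Qed.

(** Mertens' theorem for real series, applied to the four products of real and imaginary parts. *)
Lemma is_series_conv (a b : nat -> C) (la lb : C) :
  is_series a la -> is_series b lb ->
  ex_series (fun n => Cmod (a n)) -> ex_series (fun n => Cmod (b n)) ->
  is_series (conv a b) (la * lb).
Proof.
  intros Ha Hb Ea Eb. apply is_series_C in Ha, Hb.
  destruct Ha as [A1 A2], Hb as [B1 B2].
  destruct (ex_series_components a Ea) as [E1 E2]. destruct (ex_series_components b Eb) as [F1 F2].
  apply is_series_C. split.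
  - refine (is_series_ext _ _ _ _ (is_series_minus _ _ _ _
      (is_series_mult _ _ _ _ A1 B1 E1 F1) (is_series_mult _ _ _ _ A2 B2 E2 F2))).
    intros n. rewrite conv_sum_n, fst_sum_n, <- !sum_n_Reals.
    change opp with Ropp. change plus with Rplus.
    rewrite <- (Rmult_1_l (sum_n (fun k => snd (a k) * snd (b (n - k)%nat))%R n)), Ropp_mult_distr_l.
    rewrite <- (sum_n_mult_l (K := R_AbsRing)), <- (sum_n_plus (G := R_AbelianMonoid)).
    apply sum_n_ext. intros k. simpl. change plus with Rplus. change mult with Rmult. ring.
  - refine (is_series_ext _ _ _ _ (is_series_plus _ _ _ _
      (is_series_mult _ _ _ _ A1 B2 E1 F2) (is_series_mult _ _ _ _ A2 B1 E2 F1))).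
    intros n. rewrite conv_sum_n, snd_sum_n, <- !sum_n_Reals.
    rewrite <- (sum_n_plus (G := R_AbelianMonoid)).
    apply sum_n_ext. intros k. reflexivity.
Qed.

Lemma conv_scale (z : C) (a b : nat -> C) (n : nat) :
  conv (fun k => z ^ k * a k) (fun k => z ^ k * b k) n = z ^ n * conv a b n.
Proof.
  rewrite !conv_sum_n.
  transitivity (sum_n (fun k => mult (z ^ n) (a k * b (n - k)%nat)) n).
  - apply sum_n_ext_loc. intros k Hk. change mult with Cmult.
    replace (z ^ n) with (z ^ k * z ^ (n - k)) by (rewrite <- Cpow_add_r; f_equal; lia).
    change (@eq C (z ^ k * a k * (z ^ (n - k) * b (n - k)%nat)) (z ^ k * z ^ (n - k) * (a k * b (n - k)%nat))). ring.
  - now rewrite (sum_n_mult_l (K := C_AbsRing)).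
Qed.

Lemma ps_abs (c : nat -> C) (r : R) (f : C -> C) (z : C) :
  ps_on c r f -> (Cmod z < r)%R -> ex_series (fun n => Cmod (z ^ n * c n)).
Proof.
  intros Hf Hz. apply (ex_series_ext (fun n => Cmod (c n) * Cmod z ^ n)%R).
  - intros n. rewrite Cmod_mult, Cmod_pow. apply Rmult_comm.
  - apply ex_series_radius; auto using Cmod_ge_0.
    apply (ps_on_radius c r _ f Hf). split; [apply Cmod_ge_0|exact Hz].
Qed.

Lemma ps_mult (a b : nat -> C) (r : R) (f g : C -> C) :
  ps_on a r f -> ps_on b r g -> ps_on (conv a b) r (fun z => f z * g z).
Proof.
  intros Hf Hg z Hz. apply is_pseries_C.
  apply (is_series_ext (conv (fun k => z ^ k * a k) (fun k => z ^ k * b k))); [apply conv_scale|].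
  apply is_series_conv; [apply Hf| apply Hg|eapply ps_abs|eapply ps_abs]; eauto.
Qed.

Lemma ps_coef_ext (a b : nat -> C) (r : R) (f : C -> C) :
  (forall n, a n = b n) -> ps_on a r f -> ps_on b r f.
Proof.
  intros E H z Hz. apply (is_series_ext (fun n => z ^ n * a n)).
  - intros n. now rewrite E.
  - now apply H.
Qed.

Lemma ps_unique (a : nat -> C) (r : R) (f g : C -> C) (z : C) :
  ps_on a r f -> ps_on a r g -> (Cmod z < r)%R -> f z = g z.
Proof. intros H H' Hz. exact (is_series_unique_C _ _ _ (H z Hz) (H' z Hz)). Qed.

Lemma ps_le (a : nat -> C) (r s : R) (f : C -> C) : (s <= r)%R -> ps_on a r f -> ps_on a s f.
Proof. intros Hs H z Hz. apply H. lra. Qed.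

(** * Primitives, and functions with zero derivative *)

Definition icoef (c0 : C) (c : nat -> C) (n : nat) : C :=
  match n with O => c0 | S m => c m / INR (S m) end.

Lemma INR_S_neq_0 (n : nat) : RtoC (INR (S n)) <> 0.
Proof. intros E. apply RtoC_inj in E. now apply (not_0_INR (S n)). Qed.

Lemma dcoef_icoef (c0 : C) (c : nat -> C) (n : nat) : dcoef (icoef c0 c) n = c n.
Proof. unfold dcoef, icoef. field. apply INR_S_neq_0. Qed.

Lemma ps_primitive (c0 : C) (c : nat -> C) (r : R) (g : C -> C) :
  ps_on c r g ->
  ps_on (icoef c0 c) r (ps_sum (icoef c0 c)) /\
  forall z : C, (Cmod z < r)%R -> has_deriv (ps_sum (icoef c0 c)) z (g z).
Proof.
  intros Hg.
  assert (H : ps_on (icoef c0 c) r (ps_sum (icoef c0 c))).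
  { intros z Hz. apply ps_sum_correct. rewrite <- radius_dcoef.
    rewrite (CV_radius_ext _ (fun n => Cmod (c n))) by (intros n; now rewrite dcoef_icoef).
    apply (ps_on_radius c r _ g Hg). split; [apply Cmod_ge_0|exact Hz]. }
  split; [exact H|]. intros z Hz. destruct (ps_derive _ _ _ H) as [H' D].
  rewrite (ps_unique c r g (ps_sum (dcoef (icoef c0 c))) z Hg); [now apply D| |exact Hz].
  revert H'. apply ps_coef_ext. intros n. apply dcoef_icoef.
Qed.

(** The mean value theorem is a real statement, so [D] is restricted to the segment from 0 to [h]
    and followed by a 1-Lipschitz projection [p], later [fst] or [snd]. *)
Lemma zero_deriv_component (p : C -> R) (D : C -> C) (r : R) (h : C) :
  (forall z w : C, Rabs (p z - p w) <= Cmod (z - w))%R ->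
  (forall z : C, (Cmod z < r)%R -> has_deriv D z 0) -> (Cmod h < r)%R -> p (D h) = p (D 0).
Proof.
  intros Hp HD Hh.
  assert (E : p (D (RtoC 0 * h)) = p (D (RtoC 1 * h))).
  { apply (eq_is_derive (V := R_NormedModule) (fun t : R => p (D (RtoC t * h))) 0 1); [|lra].
    intros t Ht. apply is_derive_Reals. intros eps Heps.
    assert (Hth : (Cmod (t * h) < r)%R).
    { rewrite Cmod_mult, Cmod_R, Rabs_pos_eq by lra. pose proof (Cmod_ge_0 h). nra. }
    destruct (HD _ Hth) as [K [d [Hd H]]].
    assert (P := Cmod_ge_0 h). assert (Q := Rabs_pos K). assert (Q' := Rle_abs K).
    set (M := (Rabs K * (Cmod h * Cmod h) + 1)%R).
    assert (HM : (0 < M)%R) by (unfold M; nra).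
    assert (Hm : (0 < Rmin (d / (Cmod h + 1)) (eps / M))%R).
    { apply Rmin_glb_lt; apply Rdiv_lt_0_compat; lra. }
    exists (mkposreal _ Hm). simpl. intros s Hs0 Hs.
    assert (Hs1 := Rlt_le_trans _ _ _ Hs (Rmin_l _ _)). assert (Hs2 := Rlt_le_trans _ _ _ Hs (Rmin_r _ _)).
    apply Rlt_div_r in Hs1; [|lra]. apply Rlt_div_r in Hs2; [|exact HM].
    assert (PS := Rabs_pos_lt s Hs0).
    assert (A := H (s * h) ltac:(rewrite Cmod_mult, Cmod_R; nra)).
    replace (t * h + s * h) with (RtoC (t + s) * h) in A by (rewrite RtoC_plus; ring).
    replace (D (RtoC (t + s) * h) - D (t * h) - 0 * (s * h)) with (D (RtoC (t + s) * h) - D (t * h)) in A by ring.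
    rewrite Cmod_mult, Cmod_R in A.
    assert (B := Rle_trans _ _ _ (Hp (D (RtoC (t + s) * h)) (D (t * h))) A).
    rewrite Rminus_0_r, Rabs_div by exact Hs0.
    apply Rlt_div_l; [exact PS|].
    eapply Rle_lt_trans; [exact B|].
    apply Rle_lt_trans with (Rabs s * (Rabs s * (M - 1)))%R.
    - replace (Rabs s * (Rabs s * (M - 1)))%R with (Rabs K * (Rabs s * Cmod h) ^ 2)%R by (unfold M; ring).
      apply Rmult_le_compat_r; [apply pow2_ge_0|exact Q'].
    - rewrite (Rmult_comm eps). apply Rmult_lt_compat_l; [exact PS|]. nra. }
  rewrite Cmult_0_l, Cmult_1_l in E. now symmetry.
Qed.

Lemma zero_deriv_const (D : C -> C) (r : R) (h : C) :
  (forall z : C, (Cmod z < r)%R -> has_deriv D z 0) -> (Cmod h < r)%R -> D h = D 0.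
Proof.
  intros HD Hh. apply injective_projections; apply (zero_deriv_component _ D r); auto; intros z w;
    (eapply Rle_trans; [|apply Rmax_Cmod]); [apply (Rmax_l (Rabs _))|apply (Rmax_r _ (Rabs _))].
Qed.

Lemma has_deriv_minus (f g : C -> C) (z l m : C) :
  has_deriv f z l -> has_deriv g z m -> has_deriv (fun w => f w - g w) z (l - m).
Proof.
  intros Hf Hg. apply (has_deriv_ext (fun w => f w + (- (1)) * g w)).
  - exists 1%R. split; [lra|]. intros h _. ring.
  - replace (l - m) with (l + (0 * g z + (- (1)) * m)) by ring.
    apply has_deriv_plus; [exact Hf|].
    apply (has_deriv_mult (fun _ => - (1)) g); [apply has_deriv_const|exact Hg].
Qed.

Lemma same_deriv_eq (f g d : C -> C) (r : R) (h : C) :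
  (forall z : C, (Cmod z < r)%R -> has_deriv f z (d z) /\ has_deriv g z (d z)) ->
  f 0 = g 0 -> (Cmod h < r)%R -> f h = g h.
Proof.
  intros H E Hh.
  assert (A : f h - g h = f 0 - g 0).
  { apply (zero_deriv_const (fun z => f z - g z) r); [|exact Hh].
    intros z Hz. destruct (H z Hz) as [Hf Hg].
    replace (RtoC 0) with (d z - d z) by ring. now apply has_deriv_minus. }
  rewrite E in A. replace (f h) with ((f h - g h) + g h) by ring. rewrite A. ring.
Qed.

Lemma conv_ext (b d d' : nat -> C) (n : nat) :
  (forall j, (j <= n)%nat -> d j = d' j) -> conv b d n = conv b d' n.
Proof.
  intros H. rewrite !conv_sum_n. apply sum_n_ext_loc. intros k Hk. now rewrite H by lia.
Qed.

Lemma conv_quotient (b e : nat -> C) :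
  exists d : nat -> C, d O = e O /\ forall n, d (S n) = e (S n) - conv (fun k => b (S k)) d n.
Proof.
  (* Each new coefficient depends on all earlier ones, so the recursion builds tables: [tab n] is
     correct up to index [n], and the answer is the diagonal. *)
  set (tab := fix tab (n : nat) : nat -> C :=
    match n with
    | O => fun _ => e O
    | S m => fun k => if Nat.leb k m then tab m k else e (S m) - conv (fun k => b (S k)) (tab m) m
    end).
  assert (H : forall n k, (k <= n)%nat -> tab n k = tab k k).
  { induction n as [|n IH]; intros k Hk.
    - now replace k with O by lia.
    - destruct (Nat.eq_dec k (S n)) as [->|Hne]; [reflexivity|].
      simpl. replace (Nat.leb k n) with true by (symmetry; apply Nat.leb_le; lia). apply IH. lia. }
  exists (fun n => tab n n). split; [reflexivity|]. intros n.
  change (tab (S n) (S n)) with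
    (if Nat.leb (S n) n then tab n (S n) else e (S n) - conv (fun k => b (S k)) (tab n) n).
  replace (Nat.leb (S n) n) with false by (symmetry; apply Nat.leb_gt; lia).
  apply (f_equal (Cminus (e (S n)))).
  apply conv_ext. intros j Hj. now apply H.
Qed.

(** [1 + 2 + ... + 2^n = 2^(n+1) - 1]. The missing 1 leaves room for the term [e (S n)] of the
    recurrence in [conv_quotient], so the bound [2^(n+1)] reproduces itself. *)
Lemma conv_bound (b d : nat -> C) (n : nat) :
  (forall k, (Cmod (b k) <= 1)%R) -> (forall j, (j <= n)%nat -> (Cmod (d j) <= 2 ^ j)%R) ->
  (Cmod (conv b d n) <= 2 ^ (S n) - 1)%R.
Proof.
  revert b. induction n as [|n IH]; intros b Hb Hd.
  - simpl. rewrite Cmod_mult. assert (A := Hb O). assert (B := Hd O (le_n 0)). simpl in B.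
    pose proof (Cmod_ge_0 (b O)). pose proof (Cmod_ge_0 (d O)). nra.
  - simpl conv. eapply Rle_trans; [apply Cmod_triangle|]. rewrite Cmod_mult.
    assert (A := Hb O). assert (B := Hd (S n) (le_n _)).
    assert (I := IH (fun k => b (S k)) (fun k => Hb (S k)) (fun j Hj => Hd j (le_S _ _ Hj))).
    pose proof (Cmod_ge_0 (b O)). pose proof (Cmod_ge_0 (d (S n))).
    assert (Cmod (b O) * Cmod (d (S n)) <= 1 * 2 ^ S n)%R by (apply Rmult_le_compat; lra).
    simpl pow in *. lra.
Qed.

(* The logarithmic derivative [D = g' / g] is obtained from the recurrence [g D = g'], which
   bounds its coefficients by powers of 2; then [g exp (- int D)] has zero derivative. *)
Lemma exists_log_ps (b : nat -> C) (r : R) (g : C -> C) :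
  (0 < r)%R -> ps_on b r g -> b O = 1 ->
  (forall k, (Cmod (b k) <= 1)%R) -> (forall k, (Cmod (dcoef b k) <= 1)%R) ->
  exists (l : nat -> C) (s : R) (F : C -> C), (0 < s)%R /\ ps_on l s F /\ l O = 0 /\
    forall z : C, (Cmod z < s)%R -> Cexp (F z) = g z.
Proof.
  intros Hr Hg Hb0 Hb He. destruct (conv_quotient b (dcoef b)) as [d [Hd0 Hd]].
  assert (Bd : forall n j, (j <= n)%nat -> (Cmod (d j) <= 2 ^ j)%R).
  { induction n as [|n IH]; intros j Hj.
    - replace j with O by lia. rewrite Hd0. simpl. apply He.
    - destruct (Nat.eq_dec j (S n)) as [->|Hne]; [|apply IH; lia].
      rewrite Hd. unfold Cminus. eapply Rle_trans; [apply Cmod_triangle|]. rewrite Cmod_opp.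
      assert (A := conv_bound (fun k => b (S k)) d n (fun k => Hb (S k)) IH).
      specialize (He (S n)). lra. }
  assert (HD : ps_on d (1 / 2) (ps_sum d)).
  { intros z Hz. apply ps_sum_correct. apply Rbar_lt_le_trans with (Finite (1 / 2)); [exact Hz|].
    destruct (CV_radius_bounded (fun n => Cmod (d n))) as [Hub _]. apply Hub.
    exists 1%R. intros n. rewrite Rabs_pos_eq.
    - apply Rle_trans with (2 ^ n * (1 / 2) ^ n)%R.
      + apply Rmult_le_compat_r; [apply pow_le; lra|]. now apply (Bd n).
      + rewrite <- Rpow_mult_distr. replace (2 * (1 / 2))%R with 1%R by field. rewrite pow1. lra.
    - apply Rmult_le_pos; [apply Cmod_ge_0|apply pow_le; lra]. }
  destruct (ps_primitive 0 d _ _ HD) as [HF DF].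
  destruct (ps_derive b r g Hg) as [Hg' Dg].
  set (F := ps_sum (icoef 0 d)) in *.
  exists (icoef 0 d), (Rmin r (1 / 2)), F.
  pose proof (Rmin_l r (1 / 2)). pose proof (Rmin_r r (1 / 2)).
  assert (Hs : (0 < Rmin r (1 / 2))%R) by (apply Rmin_glb_lt; lra).
  split; [exact Hs|]. split; [now apply (ps_le _ (1 / 2))|]. split; [reflexivity|].
  intros z Hz.
  assert (Rec : forall w : C, (Cmod w < Rmin r (1 / 2))%R -> g w * ps_sum d w = ps_sum (dcoef b) w).
  { intros w Hw. apply (ps_unique (dcoef b) (Rmin r (1 / 2)) (fun w => g w * ps_sum d w)); [| |exact Hw].
    - apply (ps_coef_ext (conv b d)).
      + intros [|n]; simpl conv; rewrite Hb0.
        * rewrite Hd0. ring.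
        * rewrite Hd. ring.
      + apply ps_mult; [now apply (ps_le _ r)|now apply (ps_le _ (1 / 2))].
    - now apply (ps_le _ r). }
  assert (E : g z * Cexp (- F z) = g 0 * Cexp (- F 0)).
  { apply (zero_deriv_const (fun w => g w * Cexp (- F w)) (Rmin r (1 / 2))); [|exact Hz].
    intros w Hw.
    assert (DN : has_deriv (fun w => - F w) w (0 - ps_sum d w)).
    { apply (has_deriv_ext (fun w => 0 - F w)).
      - exists 1%R. split; [lra|]. intros h _. ring.
      - apply has_deriv_minus; [apply has_deriv_const|apply DF; lra]. }
    assert (DE := has_deriv_mult _ _ _ _ _ (Dg w ltac:(lra)) (has_deriv_comp _ _ _ _ _ DN (has_deriv_Cexp _))).
    replace (RtoC 0) with (ps_sum (dcoef b) w * Cexp (- F w) + g w * (Cexp (- F w) * (0 - ps_sum d w))); [exact DE|].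
    rewrite <- Rec by exact Hw. ring. }
  rewrite (ps_value_0 _ _ _ Hr Hg), (ps_value_0 _ (1 / 2) _ ltac:(lra) HF), Hb0 in E.
  simpl icoef in E. replace (- 0) with (RtoC 0) in E by ring. rewrite Cexp_0 in E.
  assert (N : Cexp (F z) * Cexp (- F z) = 1).
  { rewrite <- Cexp_plus. replace (F z + - F z) with (RtoC 0) by ring. apply Cexp_0. }
  transitivity (Cexp (F z) * (g z * Cexp (- F z))); [rewrite E; ring|].
  transitivity (g z * (Cexp (F z) * Cexp (- F z))); [ring|]. rewrite N. ring.
Qed.

(** * The extremal function *)

Lemma ps_plus (a b : nat -> C) (r : R) (f g : C -> C) :
  ps_on a r f -> ps_on b r g -> ps_on (fun n => a n + b n) r (fun z => f z + g z).
Proof.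
  intros Hf Hg z Hz.
  refine (is_series_ext _ _ _ _ (is_series_plus _ _ _ _ (Hf z Hz) (Hg z Hz))).
  intros n. to_C. ring.
Qed.

Lemma ps_scal (k : C) (a : nat -> C) (r : R) (f : C -> C) :
  ps_on a r f -> ps_on (fun n => k * a n) r (fun z => k * f z).
Proof.
  intros Hf z Hz.
  refine (is_series_ext _ _ _ _ (is_series_scal k _ _ (Hf z Hz))).
  intros n. to_C. ring.
Qed.

Lemma ps_const (k : C) (r : R) : ps_on (fun n => match n with O => k | _ => 0 end) r (fun _ => k).
Proof.
  intros z _. apply is_pseries_C. apply is_series_decr_1.
  assert (H : is_series (fun n : nat => z ^ S n * 0) (k - 1 * k)); [|exact H].
  replace (k - 1 * k) with (RtoC 0) by ring.
  apply (is_series_ext (fun _ => RtoC 0)).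
  - intros n. to_C. ring.
  - apply (filterlim_ext (fun _ => RtoC 0)); [|apply filterlim_const].
    intros n. symmetry. apply (sum_n_m_const_zero (G := C_AbelianMonoid)).
Qed.

Lemma ps_geom (u : C) : u <> 0 -> ps_on (fun n => / u ^ S n) (Cmod u) (fun h => / (u - h)).
Proof.
  intros Hu z Hz. apply Cmod_gt_0 in Hu as Hu'.
  set (c := fun n : nat => / u ^ S n).
  assert (Hc : ps_on c (Cmod u) (ps_sum c)).
  { intros w Hw. apply ps_sum_correct. apply Rbar_lt_le_trans with (Finite (Cmod u)); [exact Hw|].
    destruct (CV_radius_bounded (fun n => Cmod (c n))) as [Hub _]. apply Hub.
    exists (/ Cmod u)%R. intros n. unfold c.
    rewrite Cmod_inv, Cmod_pow by now apply Cpow_nz.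
    rewrite Rabs_pos_eq.
    - apply Req_le. simpl. field. split; [lra|]. apply pow_nonzero. lra.
    - apply Rmult_le_pos; [left; apply Rinv_0_lt_compat; now apply pow_lt|apply pow_le; lra]. }
  (* The sum is identified by telescoping: dropping the first term of [u] times the series gives [z]
     times the series. *)
  assert (E : u * ps_sum c z - z * ps_sum c z = 1).
  { assert (S1 := is_series_scal u _ _ (Hc z Hz)). apply is_series_shift in S1.
    assert (S2 := is_series_scal z _ _ (Hc z Hz)).
    apply (is_series_ext _ (fun n => z * (z ^ n * c n))) in S1.
    - assert (E := is_series_unique_C _ _ _ S1 S2).
      change (u * ps_sum c z - u * (1 * c O) = z * ps_sum c z) in E.
      rewrite <- E. replace (c O) with (/ u) by (unfold c; f_equal; simpl; ring). field. exact Hu.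
    - intros n. change (u * (z * z ^ n * / (u * u ^ S n)) = z * (z ^ n * / u ^ S n)).
      rewrite Cpow_S. field. split; [now apply Cpow_nz|exact Hu]. }
  assert (N : u - z <> 0).
  { intros A. replace z with (u - (u - z)) in Hz by ring. rewrite A in Hz.
    replace (u - 0) with u in Hz by ring. lra. }
  replace (/ (u - z)) with (ps_sum c z); [now apply Hc|].
  replace (ps_sum c z) with ((u * ps_sum c z - z * ps_sum c z) / (u - z)) by (field; exact N).
  rewrite E. field. exact N.
Qed.

Lemma one_minus_sqr_neq_0 (z : C) : (Cmod z < 1)%R -> 1 - z * z <> 0.
Proof.
  intros Hz E. assert (A : z * z = 1) by (replace (z * z) with (1 - (1 - z * z)) by ring; rewrite E; ring).
  apply (f_equal Cmod) in A. rewrite Cmod_mult, Cmod_1 in A. pose proof (Cmod_ge_0 z). nra.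
Qed.

(** Taylor coefficients at [z] of [1 / (1 - w^2)] by partial fractions, with both denominators
    written as [u - w], [u = 1] or [u = -1], to fit [ps_geom]. *)
Definition kcoef (z : C) (n : nat) : C := / 2 * (/ (1 - z) ^ S n + - (1) * / (- (1) - z) ^ S n).

Lemma ps_kernel (z : C) :
  (Cmod z < 1)%R -> ps_on (kcoef z) (1 - Cmod z) (fun h => / (1 - (z + h) * (z + h))).
Proof.
  intros Hz.
  assert (A1 := Cmod_triangle' 1 (- z)). assert (A2 := Cmod_triangle' (- (1)) (- z)).
  rewrite Cmod_opp in A1. rewrite !Cmod_opp in A2. rewrite Cmod_1 in A1, A2.
  assert (N : forall w : C, (Cmod w < 1)%R -> 1 - w <> 0 /\ - (1) - w <> 0).
  { intros w Hw. split; intros E.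
    - assert (E' : w = 1) by (replace w with (1 - (1 - w)) by ring; rewrite E; ring).
      rewrite E', Cmod_1 in Hw. lra.
    - assert (E' : w = - (1)) by (replace w with (- (1) - (- (1) - w)) by ring; rewrite E; ring).
      rewrite E', Cmod_opp, Cmod_1 in Hw. lra. }
  destruct (N z Hz) as [N1 N2].
  assert (G1 := ps_le _ _ (1 - Cmod z) _ A1 (ps_geom _ N1)).
  assert (G2 := ps_le _ _ (1 - Cmod z) _ A2 (ps_geom _ N2)).
  assert (G := ps_scal (/ 2) _ _ _ (ps_plus _ _ _ _ _ G1 (ps_scal (- (1)) _ _ _ G2))).
  intros h Hh. specialize (G h Hh).
  assert (Hzh : (Cmod (z + h) < 1)%R) by (pose proof (Cmod_triangle z h); lra).
  replace (/ (1 - (z + h) * (z + h))) with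
    (/ 2 * (/ (1 - z - h) + - (1) * / (- (1) - z - h))); [exact G|].
  destruct (N _ Hzh) as [M1 M2]. assert (M := one_minus_sqr_neq_0 _ Hzh).
  replace (1 - z - h) with (1 - (z + h)) by ring. replace (- (1) - z - h) with (- (1) - (z + h)) by ring.
  assert (M3 : -1 - (z + h) <> 0) by (replace (-1 - (z + h)) with (- (1) - (z + h)) by ring; exact M2).
  field. auto.
Qed.

(* [artanh z = z + z^3/3 + z^5/5 + ...] *)
Definition acoef : nat -> C := icoef 0 (kcoef 0).
Definition artanh (z : C) : C := ps_sum acoef z.
Definition kernel (z : C) : C := / (1 - z * z).

Lemma ps_kernel_0 : ps_on (kcoef 0) 1 kernel.
Proof.
  intros z Hz. assert (H := ps_kernel 0 ltac:(rewrite Cmod_0; lra) z).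
  rewrite Cmod_0, !Cplus_0_l in H. apply H. lra.
Qed.

Lemma ps_artanh : ps_on acoef 1 artanh.
Proof. exact (proj1 (ps_primitive 0 _ _ _ ps_kernel_0)). Qed.

Lemma has_deriv_artanh (z : C) : (Cmod z < 1)%R -> has_deriv artanh z (kernel z).
Proof. exact (proj2 (ps_primitive 0 _ _ _ ps_kernel_0) z). Qed.

Lemma has_deriv_shift (f : C -> C) (z h l : C) :
  has_deriv f (z + h) l -> has_deriv (fun w => f (z + w)) h l.
Proof.
  intros [K [d [Hd H]]]. exists K, d. split; [exact Hd|]. intros k Hk.
  rewrite Cplus_assoc. now apply H.
Qed.

(** The series at 0 is recentred without rearrangement: integrating the expansion of the kernel at
    [z] gives a function with the same derivative and the same value at [z]. *)
Lemma artanh_analytic : analytic_on unit_disk artanh.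
Proof.
  apply analytic_on_ps. intros z Hz. unfold unit_disk in Hz.
  destruct (ps_primitive (artanh z) _ _ _ (ps_kernel z Hz)) as [HP DP].
  exists (icoef (artanh z) (kcoef z)), (1 - Cmod z)%R. split; [lra|].
  intros h Hh. assert (A := HP h Hh).
  rewrite (same_deriv_eq (fun h => artanh (z + h)) (ps_sum (icoef (artanh z) (kcoef z)))
    (fun h => kernel (z + h)) (1 - Cmod z) h); [exact A| | |exact Hh].
  - intros w Hw. split; [|now apply DP].
    apply has_deriv_shift, has_deriv_artanh. pose proof (Cmod_triangle z w). lra.
  - rewrite (ps_value_0 _ (1 - Cmod z) _ ltac:(lra) HP), Cplus_0_r. reflexivity.
Qed.

(** Differentiability comes from the power series; the value follows by differentiating
    [kernel w (1 - w^2) = 1]. *)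
Lemma has_deriv_kernel (z : C) : (Cmod z < 1)%R -> has_deriv kernel z (2 * z * kernel z * kernel z).
Proof.
  intros Hz. destruct (ps_derive _ _ _ ps_kernel_0) as [_ D]. specialize (D z Hz).
  set (m := ps_sum (dcoef (kcoef 0)) z) in *.
  assert (D1 := has_deriv_mult _ _ _ _ _ D (has_deriv_minus _ _ _ _ _ (has_deriv_const 1 z)
    (has_deriv_mult _ _ _ _ _ (has_deriv_id z) (has_deriv_id z)))).
  assert (D2 := has_deriv_const 1 z).
  apply (has_deriv_ext _ (fun w => kernel w * (1 - w * w))) in D2.
  2: { exists (1 - Cmod z)%R. split; [lra|]. intros h Hh. unfold kernel. symmetry.
       apply Cinv_l. apply one_minus_sqr_neq_0. pose proof (Cmod_triangle z h). lra. }
  assert (E := has_deriv_unique _ _ _ _ D1 D2). cbv beta in E.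
  assert (N := one_minus_sqr_neq_0 z Hz).
  assert (E' : m = 2 * z * kernel z * kernel z); [|now rewrite <- E'].
  transitivity ((m * (1 - z * z) + kernel z * (0 - (1 * z + z * 1))) * kernel z + 2 * z * kernel z * kernel z).
  - unfold kernel. field. exact N.
  - rewrite E. ring.
Qed.

Lemma artanh_KS : class_KS artanh.
Proof.
  assert (A0 : artanh 0 = 0) by (rewrite (ps_value_0 _ 1 _ Rlt_0_1 ps_artanh); reflexivity).
  split.
  { split; [exact artanh_analytic|]. split; [exact A0|].
    apply has_deriv_is_derive. replace (RtoC 1) with (kernel 0).
    - apply has_deriv_artanh. rewrite Cmod_0. lra.
    - unfold kernel. field. }
  (* [q = 1/2 + z^2 / (1 - z^2)], that is [2 q = (1 + z^2) / (1 - z^2)]. *)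
  exists (fun z => - / 2 + kernel z). split.
  - apply analytic_on_ps. intros z Hz. unfold unit_disk in Hz.
    eexists. exists (1 - Cmod z)%R. split; [lra|].
    exact (ps_plus _ _ _ _ _ (ps_const (- / 2) _) (ps_kernel z Hz)).
  - intros z Hz. unfold unit_disk in Hz. assert (N := one_minus_sqr_neq_0 z Hz). split.
    + assert (D1 : has_deriv (fun w => artanh w - artanh (- w)) z (kernel z - - kernel (- z))).
      { apply has_deriv_minus; [now apply has_deriv_artanh|].
        apply has_deriv_opp_arg, has_deriv_artanh. now rewrite Cmod_opp. }
      assert (D2 : has_deriv (fun w => w * C_derive artanh w) z (1 * kernel z + z * (2 * z * kernel z * kernel z))).
      { apply (has_deriv_ext (fun w => w * kernel w)).
        - exists (1 - Cmod z)%R. split; [lra|]. intros h Hh. f_equal. symmetry.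
          apply has_deriv_C_derive, has_deriv_artanh. pose proof (Cmod_triangle z h). lra.
        - apply has_deriv_mult; [apply has_deriv_id|now apply has_deriv_kernel]. }
      rewrite (has_deriv_C_derive _ _ _ D1), (has_deriv_C_derive _ _ _ D2).
      replace (kernel (- z)) with (kernel z) by (unfold kernel; f_equal; ring).
      unfold kernel. field. exact N.
    (* Inversion maps the disk [|1 - w| < 1] onto the half-plane where the real part exceeds
       [1/2]. *)
    + set (w := 1 - z * z) in *.
      assert (Hw : (Cmod (1 - w) < 1)%R).
      { replace (1 - w) with (z * z) by (unfold w; ring). rewrite Cmod_mult.
        pose proof (Cmod_ge_0 z). nra. }
      assert (Hw2 : (Cmod (1 - w) ^ 2 < 1)%R) by (pose proof (Cmod_ge_0 (1 - w)); nra).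
      rewrite Cmod2_alt in Hw2. unfold kernel. fold w. apply Cmod_gt_0 in N.
      assert (P : (0 < Cmod w ^ 2)%R) by (apply pow_lt; exact N). rewrite Cmod2_alt in P.
      clear - Hw2 P. destruct w as [x y]. unfold Re, Im in *. simpl in *.
      replace (0 / (2 * (2 * 1) + 0 * (0 * 1)))%R with 0%R by field.
      assert (Q : (1 / 2 < x / (x * (x * 1) + y * (y * 1)))%R).
      { apply (proj1 (Rlt_div_r _ _ _ P)). lra. }
      match goal with |- (0 < - ?t + _)%R => replace t with (1 / 2)%R by field end.
      lra.
Qed.

Lemma acoef_values : acoef 0%nat = 0 /\ acoef 1%nat = 1 /\ acoef 2%nat = 0 /\ acoef 3%nat = / 3.
Proof.
  unfold acoef, icoef, kcoef. simpl. rewrite !RtoC_plus.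
  repeat split; try reflexivity; field.
Qed.

Lemma Cmod_kcoef_0 (n : nat) : (Cmod (kcoef 0 n) <= 1)%R.
Proof.
  unfold kcoef. rewrite Cmod_mult, Cmod_inv, Cmod_R, Rabs_pos_eq by (try lra; intros E; apply RtoC_inj in E; lra).
  assert (A := Cmod_triangle (/ (1 - 0) ^ S n) (- (1) * / (- (1) - 0) ^ S n)).
  replace (1 - 0) with (RtoC 1) in * by ring. replace (- (1) - 0) with (- RtoC 1) in * by ring.
  assert (C1 := C1_nz). assert (Cm1 : - RtoC 1 <> 0).
  { intros E. apply C1. replace (RtoC 1) with (- - RtoC 1) by ring. rewrite E. ring. }
  rewrite Cmod_mult, !Cmod_inv, !Cmod_pow, !Cmod_opp, Cmod_1, pow1 in A by now apply Cpow_nz.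
  rewrite Rinv_1 in A. lra.
Qed.

Lemma artanh_log_coeffs : exists gamma, is_log_coeffs artanh gamma.
Proof.
  destruct acoef_values as [V0 [V1 _]].
  assert (Hg := ps_shift _ _ _ ps_artanh).
  set (g := fun z => if Ceq_dec z 0 then acoef 1%nat else (artanh z - acoef 0%nat) / z) in *.
  assert (HI : forall n, (1 <= INR (S n))%R) by (intros n; rewrite S_INR; pose proof (pos_INR n); lra).
  (* Both bounds required by [exists_log_ps] follow from this one, which holds because the
     coefficients of the kernel are at most 1 in modulus. *)
  assert (HB : forall k, (Cmod (acoef (S k)) * INR (S k) <= 1)%R).
  { intros k. unfold acoef, icoef. rewrite Cmod_div, Cmod_R, Rabs_pos_eq by (apply INR_S_neq_0 || apply pos_INR).
    replace (Cmod (kcoef 0 k) / INR (S k) * INR (S k))%R with (Cmod (kcoef 0 k)).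
    - apply Cmod_kcoef_0.
    - field. specialize (HI k). lra. }
  destruct (exists_log_ps (fun n => acoef (S n)) 1 g Rlt_0_1 Hg V1) as [l [s [F [Hs [HF [Hl HE]]]]]].
  - intros k. specialize (HB k). specialize (HI k). pose proof (Cmod_ge_0 (acoef (S k))). nra.
  - intros k. rewrite Cmod_dcoef. unfold PS_derive. specialize (HB (S k)).
    rewrite (S_INR (S k)) in HB. pose proof (Cmod_ge_0 (acoef (S (S k)))). nra.
  - exists (fun n => l n / 2), F. split; [now rewrite (ps_value_0 _ _ _ Hs HF)|]. split.
    + apply locally_C. exists s. split; [exact Hs|]. intros h Hh Hn. rewrite Cplus_0_l in *.
      rewrite HE by exact Hh. unfold g. destruct (Ceq_dec h 0) as [->|_]; [easy|].
      rewrite V0. f_equal. ring.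
    + apply locally_C. exists s. split; [exact Hs|]. intros h Hh. rewrite Cplus_0_l.
      apply (ps_coef_ext l _ s); [|exact HF|exact Hh].
      intros [|n]; [exact Hl|]. simpl. field.
Qed.

Theorem theorem2p4 :
  (forall (f : C -> C) (gamma : nat -> C),
     class_KS f -> is_log_coeffs f gamma ->
     (Cmod (H21 gamma) <= 1 / 36)%R) /\
  (exists (f : C -> C) (gamma : nat -> C),
     class_KS f /\ is_log_coeffs f gamma /\
     Cmod (H21 gamma) = (1 / 36)%R).
Proof.
  split; [exact KS_hankel_bound|].
  destruct artanh_log_coeffs as [gamma HL]. exists artanh, gamma.
  split; [exact artanh_KS|]. split; [exact HL|].
  destruct acoef_values as [V0 [V1 [V2 V3]]].
  destruct (is_log_coeffs_relations artanh gamma acoef 1 Rlt_0_1 ps_artanh V0 V1 HL) as [G1 [G2 _]].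
  rewrite V2 in G1, G2. rewrite V3 in G2.
  assert (E1 : gamma 1%nat = 0).
  { transitivity (2 * gamma 1%nat / 2); [field|rewrite <- G1; field]. }
  assert (E2 : gamma 2%nat = / 6).
  { rewrite E1 in G2. transitivity ((2 * 0 * 0 + 4 * gamma 2%nat) / 4); [field|rewrite <- G2; field]. }
  (* With [gamma 1 = 0] the determinant reduces to [- (gamma 2)^2 = - 1/36]. *)
  unfold H21. rewrite E1, E2.
  replace (0 * gamma 3%nat - / 6 * / 6) with (RtoC (- (1 / 36))).
  - rewrite Cmod_R, Rabs_Ropp, Rabs_pos_eq; lra.
  - rewrite RtoC_opp, RtoC_div by lra. field.
Qed.
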